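(* Let $P_2(L)$ be the number of polygons in the $L\times L$ square having at least one edge in each of the top and bottom sides of the square, and let $P_4(L)$ be the number of polygons in the $L\times L$ square having at least one edge in each of the four sides of the square. Then, as $L\to\infty$, $$P_2(L)=\lambda^{L^2+O(L)}\qquad\text{and}\qquad P_4(L)=\lambda^{L^2+O(L)} ,$$ where $\log\lambda=\lim_{L\to\infty}L^{-2}\log C(L)$ and $C(L)$ is the number of self-avoiding walks crossing the $L\times L$ square from one corner vertex to the opposite corner vertex.
   Context: For a positive integer $L$, the $L\times L$ square is the subgraph of the square lattice $\mathbb{Z}^2$ (nearest-neighbour edges) induced by the vertex set $\{0,1,\dots,L\}^2$. Its bottom, top, left and right sides are the sets of edges of the square lying in the lines $y=0$, $y=L$, $x=0$, $x=L$ respectively. A self-avoiding walk is a nearest-neighbour lattice path that visits no vertex more than once. $C(L)$ is the number of self-avoiding walks that stay in the $L\times L$ square, start at a fixed corner vertex (say $(0,0)$) and end at the opposite corner vertex (say $(L,L)$). It is known from earlier work that $\lim_{L\to\infty} L^{-2}\log C(L)$ exists and is finite; $\lambda$ is defined by setting this limit equal to $\log\lambda$. A polygon is a simple closed cycle, regarded as an (unrooted, unoriented) subgraph of the lattice; polygons in the square are counted as distinct subgraphs of the fixed square (translates are counted as different). The notation $A(L)=\lambda^{L^2+O(L)}$ means $\log A(L)=(L^2+r(L))\log\lambda$ with $|r(L)|\le KL$ for some constant $K$ and all sufficiently large $L$. *)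

(* Defs.v *)
From mathcomp Require Import all_boot all_order all_algebra.
From mathcomp Require Import all_classical all_reals all_analysis.

Set Implicit Arguments.
Unset Strict Implicit.
Unset Printing Implicit Defensive.

Import Order.TTheory GRing.Theory Num.Theory numFieldNormedType.Exports.

Local Open Scope nat_scope.

(* A vertex (x, y) of the square {0, ..., L}^2. *)
Definition vertex (L : nat) : finType := ('I_L.+1 * 'I_L.+1)%type.

(* The differences are in int; they are not truncated. *)
Definition adj (L : nat) (u v : vertex L) : bool :=
  `|(u.1 : nat) - (v.1 : nat)|%N + `|(u.2 : nat) - (v.2 : nat)|%N == 1.

Definition edges (L : nat) : {set {set vertex L}} :=
  [set e : {set vertex L} | [exists u, exists v, adj u v && (e == [set u; v])]].

Definition bottom_side (L : nat) : {set {set vertex L}} :=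
  [set e in edges L | [forall v in e, v.2 == 0 :> nat]].
Definition top_side (L : nat) : {set {set vertex L}} :=
  [set e in edges L | [forall v in e, v.2 == L :> nat]].
Definition left_side (L : nat) : {set {set vertex L}} :=
  [set e in edges L | [forall v in e, v.1 == 0 :> nat]].
Definition right_side (L : nat) : {set {set vertex L}} :=
  [set e in edges L | [forall v in e, v.1 == L :> nat]].

(* A walk is a starting vertex followed by the sequence p of the next vertices.
   The bound #|vertex L| on the size of p only serves to have a finite type:
   it holds for every p without repetition. *)
Definition crossing_saws (L : nat) : {set #|vertex L|.-bseq (vertex L)} :=
  let a : vertex L := (ord0, ord0) in
  let b : vertex L := (ord_max, ord_max) in
  [set p : #|vertex L|.-bseq (vertex L) |
    [&& path (@adj L) a p, uniq (a :: p) & last a p == b]].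

Definition C (L : nat) : nat := #|crossing_saws L|.

Definition cycle_edges (L : nat) (c : seq (vertex L)) : {set {set vertex L}} :=
  [set [set v; next c v] | v in c].

(* A polygon is identified with its set of edges, so that all the rooted and
   oriented traversals c of the same cycle are counted once.  The bound 2 < size c
   excludes an edge traversed back and forth. *)
Definition polygons (L : nat) : {set {set {set vertex L}}} :=
  [set cycle_edges c
    | c : #|vertex L|.-bseq (vertex L) & (2 < size c) && ucycleb (@adj L) c].

Definition has_edge_in (L : nat) (E S : {set {set vertex L}}) : bool :=
  [exists e in E, e \in S].

Definition P2 (L : nat) : nat :=
  #|[set E in polygons L |
      has_edge_in E (top_side L) && has_edge_in E (bottom_side L)]|.

Definition P4 (L : nat) : nat :=
  #|[set E in polygons L |
      [&& has_edge_in E (top_side L), has_edge_in E (bottom_side L),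
          has_edge_in E (left_side L) & has_edge_in E (right_side L)]]|.

Local Open Scope classical_set_scope.
Local Open Scope ring_scope.

(* A(L) = lam^(L^2 + O(L)).  The positivity of A(L) is part of the definition
   because [ln] is totalized by [ln 0 = 0]. *)
Definition eq_pow_sqr_bigO (R : realType) (lam : R) (A : nat -> nat) : Prop :=
  exists (r : nat -> R) (K : R), \forall L \near \oo,
    [/\ (0 < A L)%N,
        ln (A L)%:R = (L%:R ^+ 2 + r L) * ln lam &
        `|r L| <= K * L%:R].

(* Main.v *)
(** A crossing walk of the square of side L, flipped and shifted by (1, 1),
    closes up along the left and bottom sides of the square of side L + 1 to a
    polygon meeting all four sides, so C(L) <= P4(L+1) <= P2(L+1). Conversely
    a polygon opened at a highest horizontal edge, with legs added from there
    to two opposite corners, becomes a crossing walk, so P2(L) is at most 1 +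
    (L+1)^2 C(L+1). It remains to see that log C(L) = L^2 log lam + O(L).

    Upper bound: putting together alternately reflected copies of walks gives
    C(n-1)^(9^j) <= C(3^j n - 1), whence log C(n-1) <= n^2 log lam.

    Lower bound: cut the polygons of a box along a vertical line. The left
    part is a system of disjoint paths whose ends lie on the line. It is
    closed into a single polygon within two extra columns, going through the
    ends from bottom to top and keeping two ends s < t open. With y1 < y2 the
    next ends, either t is linked to y1 through the first column, leaving s <
    y2 open, or s is linked to t through the second column, leaving y1 < y2
    open. The path starting at t cannot end both at y1 and at s, so one of the
    links does not close a loop too early. The paths can be read off from the
    resulting polygon, so the number Q(m, n) of polygons of a box satisfies
    Q(a + b, n) <= 2^n Q(a + 2, n) Q(b + 2, n), the factor 2^n accounting for
    the edges that cross the line. Iterating in both directions bounds C(kd)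
    by (e^{O(d)} C(d + 4))^(k^2), whence d^2 log lam <= log C(d + 4) + O(d). *)
Require Import Defs.
From mathcomp Require Import all_boot all_order all_algebra.
From mathcomp Require Import all_classical all_reals all_analysis.
From mathcomp Require Import fintype finset zify ring lra.

Set Implicit Arguments.
Unset Strict Implicit.
Unset Printing Implicit Defensive.

Import Order.TTheory GRing.Theory Num.Theory numFieldNormedType.Exports.

Section Combinatorics.
Local Open Scope nat_scope.

(** * Edges of lists of vertices *)

Section Traces.

Variable T : eqType.
Implicit Types (x y u v : T) (p q s w : seq T) (ps : seq (seq T)).

(** Edges are unoriented, so reversing a list, or rotating a closed one, does not change the
    relation it defines. Walks and polygons are compared only through these relations. *)
Definition link x y u v := ((u == x) && (v == y)) || ((u == y) && (v == x)).

Fixpoint pedge x p u v :=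
  if p is y :: p' then link x y u v || pedge y p' u v else false.

Definition edge_in s u v := if s is x :: p then pedge x p u v else false.

Definition cedge s u v :=
  if s is x :: p then pedge x (rcons p x) u v else false.

Lemma linkC x y u v : link x y u v = link y x u v.
Proof. by rewrite /link orbC. Qed.

Lemma link_sym x y u v : link x y u v = link x y v u.
Proof. by rewrite /link orbC; congr (_ || _); apply: andbC. Qed.

(** Used with [P] the region kept: an edge with an endpoint outside the region leaves no trace in
    it. *)
Lemma link_out (P : pred T) x y u v : ~~ P x -> P u -> P v ->
  link x y u v = false.
Proof.
move=> Px Pu Pv; rewrite /link.
have [ux vx] : u != x /\ v != x by split; apply: contraNneq Px => <-.
by rewrite (negPf ux) (negPf vx) andbF.
Qed.

Lemma pedge_cat x p y q u v :
  pedge x (p ++ y :: q) u v =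
  [|| pedge x p u v, link (last x p) y u v | pedge y q u v].
Proof. by elim: p x => //= z p IH x; rewrite IH -orbA. Qed.

Lemma pedge_rcons x p y u v :
  pedge x (rcons p y) u v = pedge x p u v || link (last x p) y u v.
Proof. by rewrite -cats1 pedge_cat /= orbF. Qed.

Lemma edge_in_cat x p y q u v :
  edge_in ((x :: p) ++ y :: q) u v =
  [|| edge_in (x :: p) u v, link (last x p) y u v | edge_in (y :: q) u v].
Proof. exact: pedge_cat. Qed.

Lemma edge_in_sym s u v : edge_in s u v = edge_in s v u.
Proof.
case: s => //= x p; elim: p x => //= y p IH x.
by rewrite IH link_sym.
Qed.

Lemma edge_in_rcons2 s x y u v :
  edge_in (rcons (rcons s x) y) u v = edge_in (rcons s x) u v || link x y u v.
Proof. by case: s => [|z s] /=; rewrite ?orbF // pedge_rcons last_rcons. Qed.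

Lemma edge_in_rev s u v : edge_in (rev s) u v = edge_in s u v.
Proof.
elim: s => // x [|y s] IH //.
by rewrite !rev_cons edge_in_rcons2 -rev_cons IH orbC /= linkC.
Qed.

Lemma edge_in_mem s u v : edge_in s u v -> (u \in s) && (v \in s).
Proof.
case: s => //= x p; elim: p x => //= y p IH x /orP[|/IH/andP[up vp]].
  by case/orP=> /andP[/eqP-> /eqP->]; rewrite !inE !eqxx ?orbT.
by rewrite inE up orbT inE vp orbT.
Qed.

Lemma cedge_mem s u v : cedge s u v -> (u \in s) && (v \in s).
Proof.
case: s => // x p uv.
have /edge_in_mem := uv : edge_in (x :: rcons p x) u v.
by rewrite !inE !mem_rcons !inE !orbA !orbb.
Qed.

Lemma cedge_sym s u v : cedge s u v = cedge s v u.
Proof. by case: s => // x p; apply: (edge_in_sym (x :: rcons p x)). Qed.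

Lemma cedge_rel (e : rel T) c u v :
  cycle e c -> cedge c u v -> e u v || e v u.
Proof.
case: c => // x p; rewrite /cycle /cedge.
move: (rcons p x) => q; elim: q x => //= z q IH y /andP[yz zq] /orP[|].
  by case/orP=> /andP[/eqP-> /eqP->]; rewrite yz ?orbT.
exact: (IH _ zq).
Qed.

Lemma cedge_cat x p y q u v :
  cedge ((x :: p) ++ y :: q) u v =
  [|| edge_in (x :: p) u v, link (last x p) y u v, edge_in (y :: q) u v
    | link (last y q) x u v].
Proof. by rewrite /= rcons_cat /= pedge_cat pedge_rcons. Qed.

Lemma cedge_rot k s u v : cedge (rot k s) u v = cedge s u v.
Proof.
rewrite -[in RHS](cat_take_drop k s) /rot.
case: (take k s) (drop k s) => [|x p] [|y q] //; rewrite ?cats0 //.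
rewrite !cedge_cat.
by case: (edge_in (x :: p) u v); case: (edge_in (y :: q) u v);
  rewrite /= ?orbT //= orbC.
Qed.

End Traces.

(** * Systems of disjoint paths *)

Section PathSystems.

Variables (T : eqType) (e : rel T).
Hypothesis e_sym : symmetric e.
Implicit Types (x y u v : T) (p q s w : seq T) (ps : seq (seq T)).

(** Paths of one vertex are excluded: they carry no edge, and their two tips would coincide. *)
Definition path_system ps :=
  uniq (flatten ps) && all (fun p => sorted e p && (1 < size p)) ps.

Definition tips p := if p is x :: q then [:: x; last x q] else [::].

Definition ends ps := flatten (map tips ps).

Definition edge_of ps u v := has (fun p => edge_in p u v) ps.

Lemma tips_rev p : perm_eq (tips (rev p)) (tips p).
Proof.
case: p => // x p; rewrite rev_cons.
case: (lastP p) => [|q y] //; rewrite rev_rcons /= !last_rcons.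
by rewrite (perm_catC [:: y] [:: x]).
Qed.

Lemma sorted_rev p : sorted e (rev p) = sorted e p.
Proof. by rewrite rev_sorted; apply: eq_sorted => x y; rewrite e_sym. Qed.

Lemma sorted_cat x p y q :
  sorted e ((x :: p) ++ y :: q) =
  [&& sorted e (x :: p), e (last x p) y & sorted e (y :: q)].
Proof. by rewrite /= cat_path. Qed.

Lemma perm_flatten ps ps' : perm_eq ps ps' ->
  perm_eq (flatten ps) (flatten ps').
Proof.
move=> H; apply/permP => a; rewrite !count_flatten.
by apply: perm_sumn; apply: perm_map.
Qed.

(** Reordering the paths and reversing one of them brings a given end to the front, without
    affecting vertices, ends or edges. *)
Lemma expose_end ps u : path_system ps -> u \in ends ps ->
  exists p ps', [/\ path_system ((u :: p) :: ps'),
    perm_eq (flatten ps) (flatten ((u :: p) :: ps')),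
    perm_eq (ends ps) (ends ((u :: p) :: ps')) &
    edge_of ps =2 edge_of ((u :: p) :: ps')].
Proof.
move=> /andP[U A] /flattenP[t /mapP[p0 p0ps ->] ut].
have Pm := perm_to_rem p0ps; set ps' := rem p0 ps in Pm.
(* The path is kept if [u] is its first tip and reversed if [u] is its last one. *)
have [p [q [E Ep]]] : exists p q, q = u :: p /\ (q = p0 \/ q = rev p0).
  case: p0 ut {p0ps Pm ps'} => // x p; rewrite !inE => /orP[/eqP->|/eqP->].
    by exists p, (x :: p); split; [|left].
  rewrite rev_cons; case: (lastP p) => [|p' y].
    by exists [::], [:: x]; split; [|left].
  rewrite rev_rcons last_rcons;
    exists (rcons (rev p') x), (y :: rcons (rev p') x).
  by split; [|right].
have Pq : perm_eq q p0 by case: Ep => -> //; rewrite perm_rev.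
have PF : perm_eq (flatten ps) (flatten (q :: ps')).
  rewrite (perm_trans (perm_flatten Pm)) //=.
  by rewrite perm_cat2r perm_sym.
exists p, ps'; rewrite -E; split => //.
- rewrite /path_system -(perm_uniq PF) U /=.
  move: A; rewrite (perm_all _ Pm) /= => /andP[A ->].
  by rewrite (perm_size Pq) andbT; case: Ep => ->; rewrite ?sorted_rev.
- rewrite /ends (perm_trans (perm_flatten (perm_map _ Pm))) //=.
  rewrite perm_cat2r perm_sym.
  by case: Ep => ->; rewrite // tips_rev.
move=> x y; rewrite /edge_of (perm_has _ Pm) /=; congr (_ || _).
by case: Ep => ->; rewrite ?edge_in_rev.
Qed.

Lemma ends_sub ps : {subset ends ps <= flatten ps}.
Proof.
move=> x /flattenP[t /mapP[p pps ->] xt]; apply/flattenP; exists p => //.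
case: p xt {pps} => // y p; rewrite !inE => /orP[->//|/eqP->].
by rewrite -in_cons mem_last.
Qed.

Lemma uniq_ends ps : path_system ps -> uniq (ends ps).
Proof.
elim: ps => // p ps IH; rewrite /path_system /= cat_uniq.
move=> /andP[/and3P[Up H Uf] /andP[/andP[_ sp] A]].
rewrite cat_uniq IH ?andbT; last by rewrite /path_system Uf.
apply/andP; split.
  case: p Up sp {H} => // x [|y p] //= /andP[xp _] _.
  by rewrite andbT inE; apply: contraNneq xp => ->; apply: mem_last.
apply: contra H => /hasP[x /ends_sub xf xp].
apply/hasP; exists x => //; have := @ends_sub [:: p] x.
by rewrite /ends /= !cats0 => /(_ xp).
Qed.

Lemma size_ends ps : path_system ps -> size (ends ps) = (size ps).*2.
Proof.
elim: ps => // p ps IH; rewrite /path_system /= cat_uniq.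
move=> /andP[/and3P[Up H Uf] /andP[/andP[_ sp] A]].
rewrite /ends /= size_cat IH; last by rewrite /path_system Uf.
by case: p sp {Up H}.
Qed.

(** The first path is run backwards to [u], then [w] leads to [v], where the second path starts.
    Both [u] and [v] become interior vertices. *)
Lemma join_ends u p v q ps w :
  path_system [:: u :: p, v :: q & ps] ->
  sorted e (u :: rcons w v) -> w != [::] -> uniq w ->
  ~~ has (mem (flatten [:: u :: p, v :: q & ps])) w ->
  let ps' := (rev (u :: p) ++ w ++ v :: q) :: ps in
  [/\ path_system ps',
    perm_eq (flatten ps') (w ++ flatten [:: u :: p, v :: q & ps]),
    perm_eq (ends [:: u :: p, v :: q & ps]) [:: u, v & ends ps'] &
    forall x y, edge_of ps' x y =
      edge_of [:: u :: p, v :: q & ps] x y || edge_in (u :: rcons w v) x y].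
Proof.
case: w => // w0 w; move=> /andP[U A0] Sw _ Uw Hw.
have /and3P[/andP[Sp sp] /andP[Sq sq] A] :
  [&& sorted e (u :: p) && (1 < size (u :: p)),
      sorted e (v :: q) && (1 < size (v :: q)) &
      all (fun p => sorted e p && (1 < size p)) ps] := A0.
set W := w0 :: w in Uw Hw Sw *; move=> ps'.
have PF : perm_eq (flatten ps') (W ++ flatten [:: u :: p, v :: q & ps]).
  rewrite -[flatten ps']/((rev (u :: p) ++ W ++ v :: q) ++ flatten ps).
  rewrite -[flatten [:: u :: p, v :: q & ps]]/((u :: p) ++ (v :: q) ++ flatten
    ps).
  by rewrite -2!catA perm_catCA perm_cat2l perm_cat2r perm_rev.
(* The path has at least two vertices, so reversed it starts at a vertex [z] before reaching [u];
   [z] is its other tip. *)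
have [z [r E]] : exists z r, rev (u :: p) = rcons (z :: r) u.
  rewrite rev_cons; case: (lastP p) sp => // p' z _.
  by rewrite rev_rcons; exists z, (rev p').
have Srev : sorted e (rcons (z :: r) u) by rewrite -E sorted_rev.
split => //.
- rewrite /path_system (perm_uniq PF) cat_uniq Uw U andbT.
  have -> : ~~ has (mem W) (flatten [:: u :: p, v :: q & ps]).
    by apply: contra Hw => /hasP[x xf xw]; apply/hasP; exists x.
  rewrite /ps' /= [all _ ps]A andbT; apply/andP; split; last first.
    by rewrite size_cat size_rev /= addnS.
  rewrite E cat_rcons.
  move: Srev; rewrite -cats1 !sorted_cat => /and3P[-> -> _] /=.
  by move: Sw Sq; rewrite /= rcons_path cat_path /= => /and3P[-> -> ->] ->.
- rewrite /ps' /ends E /= last_cat /= last_cat /=.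
  have -> : last u p = z.
    by have := congr1 (fun s => last u (rev s)) E;
      rewrite revK rev_rcons /= rev_cons last_rcons.
  by rewrite perm_cons; apply/permPl/(perm_catCA [:: z] [:: v]).
move=> x y; rewrite /ps' /edge_of /=.
have -> : edge_in (rev (u :: p) ++ w0 :: w ++ v :: q) x y =
    [|| pedge u p x y, link u w0 x y, pedge w0 (rcons w v) x y | pedge v q x y].
  rewrite -[pedge u p x y]/(edge_in (u :: p) x y) -(edge_in_rev (u :: p)) E
    cat_rcons.
  by rewrite /= !pedge_rcons pedge_cat /= pedge_cat -!orbA.
case: (pedge u p x y) => //=; case: (pedge v q x y) => //=;
  rewrite ?orbT ?orbF //.
by rewrite orbC.
Qed.

(* If the path starts in [P], then so does the first piece [p]; all the other
   tips of the pieces are next to a vertex outside [P]. *)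
Lemma cut_path (P good : pred T) x s :
  (forall y z, P y -> ~~ P z -> e y z -> good y) ->
  path e x s -> ~~ P (last x s) ->
  exists p ps, [/\ flatten (p :: ps) = seq.filter P (x :: s),
    ohead p = (if P x then Some x else None),
    all (sorted e) (p :: ps),
    all good (behead (tips p) ++ ends ps) &
    forall u v, P u -> P v -> edge_in (x :: s) u v = edge_of (p :: ps) u v].
Proof.
move=> goodP; elim: s x => [|y s IH] x.
  by move=> _ /= /negPf Px; exists [::], [::]; rewrite Px; split.
rewrite [path _ _ _]/= [last _ _]/= => /andP[exy pys] nl.
have {IH} [p [ps [Fp Hp Sp Gp Ep]]] := IH y pys nl.
case: (boolP (P x)) => Px; last first.
  exists [::], (p :: ps); rewrite /= (negPf Px); split=> //.
    case: p Fp Hp Sp Gp Ep => // z p Fp /=.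
    case: (boolP (P y)) => // Py [->] Sp Gp _.
    by rewrite Gp andbT (goodP _ _ Py Px) // e_sym.
  move=> u v Pu Pv; have := Ep u v Pu Pv.
  by rewrite (link_out y Px) //= => ->.
exists (x :: p), ps; split.
- by have := congr1 (cons x) Fp; rewrite /= Px.
- by [].
- case: p Hp {Fp Gp Ep} Sp => // z p /=.
  by case: (P y) => // -[->]; rewrite exy.
- case: p Hp {Fp Sp Ep} Gp => [|z p] //=.
  case: (boolP (P y)) => // Py _ ->; rewrite andbT.
  exact: goodP exy.
move=> u v Pu Pv; rewrite /= -[pedge y s u v]/(edge_in (y :: s) u v) Ep //.
case: p Hp {Fp Gp Sp Ep} => [|z p] /=.
  by case: (boolP (P y)) => // Py _; rewrite linkC (link_out x Py).
by case: (P y) => // -[->]; rewrite orbA.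
Qed.

(** As [x] lies outside [P], the first piece of the cut is empty; pieces of one vertex are dropped,
    since they carry no edge. Only the filtered list has to be free of repetition, because in a
    closed traversal [x] occurs again at the end. *)
Lemma cut_path_system (P good : pred T) x s :
  (forall y z, P y -> ~~ P z -> e y z -> good y) ->
  path e x s -> ~~ P x -> ~~ P (last x s) -> uniq (seq.filter P s) ->
  exists ps, [/\ path_system ps, {subset flatten ps <= seq.filter P s},
    all good (ends ps) &
    forall u v, P u -> P v -> edge_in (x :: s) u v = edge_of ps u v].
Proof.
move=> goodP pxs Px Pl.
have [p [ps [Fp Hp Sp Gp Ep]]] := cut_path goodP pxs Pl.
case: p Fp Hp Sp Gp Ep; rewrite (negPf Px) // => Fp _ /= Sp Gp Ep Us.
rewrite /= (negPf Px) in Fp.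
pose ps' := [seq p <- ps | 1 < size p].
have sub : subseq (flatten ps') (flatten ps).
  rewrite /ps'; elim: (ps) => //= p qs IH; case: ifP => _ /=.
    by apply: cat_subseq.
  by apply: subseq_trans IH (suffix_subseq _ _).
have sube : subseq (ends ps') (ends ps).
  rewrite /ends /ps'; elim: (ps) => //= p qs IH; case: ifP => _ /=.
    by apply: cat_subseq.
  by apply: subseq_trans IH (suffix_subseq _ _).
exists ps'; split.
- rewrite /path_system (subseq_uniq sub) ?Fp //=.
  apply/allP => p; rewrite mem_filter => /andP[-> pps].
  by rewrite (allP Sp).
- by rewrite -Fp; apply: mem_subseq.
- by apply/allP => z /(mem_subseq sube); apply: (allP Gp).
move=> u v Pu Pv; rewrite Ep // /edge_of /= /ps'.
elim: (ps) => //= p qs ->; case: ifP => //.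
by case: p => [|z [|]].
Qed.

(** Since [w] is not empty, every edge of the bridge has an endpoint in [w], so no edge is added
    between old vertices. *)
Definition bridge ps u v w :=
  [&& sorted e (u :: rcons w v), w != [::], uniq w & ~~ has (mem (flatten ps))
    w].

Lemma bridge_rev ps u v w : bridge ps u v w -> bridge ps v u (rev w).
Proof.
move=> /and4P[Sw w0 Uw Dw]; apply/and4P; split.
- by rewrite -rev_cons -rev_rcons sorted_rev.
- by apply: contra w0; rewrite -!size_eq0 size_rev.
- by rewrite rev_uniq.
by rewrite has_rev.
Qed.

(** Quantifying over all bridges separates the choice of the two ends to be linked from the geometry
    of the link. *)
Definition joinable ps u v := forall w, bridge ps u v w ->
  exists ps', [/\ path_system ps',
    perm_eq (flatten ps') (w ++ flatten ps),
    perm_eq (ends ps) [:: u, v & ends ps'] &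
    forall x y, edge_of ps' x y = edge_of ps x y || edge_in (u :: rcons w v) x
      y].

(** Here [v] is an end of a path other than the one starting at [u], so linking them closes no
    loop. *)
Lemma joinable_exposed ps u p ps1 v : path_system ((u :: p) :: ps1) ->
  perm_eq (flatten ps) (flatten ((u :: p) :: ps1)) ->
  perm_eq (ends ps) (ends ((u :: p) :: ps1)) ->
  edge_of ps =2 edge_of ((u :: p) :: ps1) ->
  v \in ends ps1 -> joinable ps u v.
Proof.
move=> Sp Fp Np Ep v1 w /and4P[Sw w0 Uw Dw].
have S1 : path_system ps1.
  move: Sp; rewrite /path_system /= cat_uniq.
  by case/andP=> /and4P[_ _ _ ->] /andP[_ ->].
have [q [ps2 [S2 F2 N2 E2]]] := expose_end S1 v1.
have PF : perm_eq (flatten ps) (flatten [:: u :: p, v :: q & ps2]).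
  by rewrite (perm_trans Fp) //= perm_cons perm_cat2l.
have S' : path_system [:: u :: p, v :: q & ps2].
  rewrite /path_system -(perm_uniq PF) (perm_uniq Fp).
  move: Sp; rewrite /path_system => /andP[-> A1].
  by move: A1 S2; rewrite /path_system /= => /andP[-> _] /andP[_ ->].
have Dw' : ~~ has (mem (flatten [:: u :: p, v :: q & ps2])) w.
  by rewrite -(eq_has (perm_mem PF)).
have [Sj Fj Nj Ej] := join_ends S' Sw w0 Uw Dw'.
eexists; split; first exact: Sj.
- by rewrite (perm_trans Fj) // perm_cat2l perm_sym.
- rewrite (perm_trans _ Nj) // (perm_trans Np) //.
  by rewrite /ends [flatten _]/= [flatten (map _ (_ :: _))]/= !perm_cons.
move=> x y; rewrite Ej Ep; congr (_ || _).
by rewrite /edge_of /= -/(edge_of ps1 x y) E2.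
Qed.

(* The path starting at [u] cannot end both at [v] and at [v']. *)
Lemma joinable_or ps u v v' : path_system ps -> uniq [:: u; v; v'] ->
  {subset [:: u; v; v'] <= ends ps} -> joinable ps u v \/ joinable ps u v'.
Proof.
move=> Sp; rewrite /= !inE negb_or => /and3P[/andP[uv uv'] vv' _] sub.
have [p [ps1 [S1 F1 N1 E1]]] := expose_end Sp (sub u (mem_head _ _)).
have [vin v'in] : v \in ends ps /\ v' \in ends ps.
  by split; apply: sub; rewrite !inE eqxx ?orbT.
have inN z : z != u -> z \in ends ((u :: p) :: ps1) ->
  (z == last u p) || (z \in ends ps1).
  by rewrite /ends /= !inE => /negPf->.
move: vin v'in; rewrite !(perm_mem N1).
move=> /(inN v); rewrite eq_sym uv => /(_ isT) H1.
move=> /(inN v'); rewrite eq_sym uv' => /(_ isT) H2.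
case/orP: H1 => [/eqP Ev|H1]; last by left;
  exact: joinable_exposed S1 F1 N1 E1 H1.
right; case/orP: H2 => [/eqP Ev'|H2];
  last by exact: joinable_exposed S1 F1 N1 E1 H2.
by move: vv'; rewrite Ev Ev' eqxx.
Qed.

(** Two ends mean a single path, from [u] to [v]; the cycle is this path reversed, followed by
    [w]. *)
Lemma close_ends ps u v w : path_system ps -> perm_eq (ends ps) [:: u; v] ->
  bridge ps u v w ->
  exists c, [/\ ucycleb e c, perm_eq c (w ++ flatten ps) &
    forall x y, cedge c x y = edge_of ps x y || edge_in (u :: rcons w v) x y].
Proof.
move=> Sp Np /and4P[Sw w0 Uw Dw].
have u1 : u \in ends ps by rewrite (perm_mem Np) mem_head.
have [p [ps1 [S1 F1 N1 E1]]] := expose_end Sp u1.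
have Z : ps1 = [::].
  have := size_ends S1; rewrite -(perm_size N1) (perm_size Np) /=.
  by case: (ps1).
rewrite {ps1}Z in S1 F1 N1 E1.
have Lp : last u p = v.
  have : perm_eq [:: u; v] (ends [:: u :: p]) by rewrite -(permPl Np).
  by rewrite /ends /= perm_cons => /perm_mem /(_ v);
    rewrite !inE eqxx => /esym/eqP.
move: F1 S1; rewrite /= cats0 => F1 /andP[/=];
  rewrite cats0 => U1 /andP[/andP[S1 p1] _].
have [r Er] : exists r, rev (u :: p) = v :: r.
  case: (lastP p) Lp p1 => // p' y; rewrite last_rcons => -> _.
  by rewrite -rcons_cons rev_rcons; eexists.
have Lr : last v r = u by have := last_rcons u (rev p) u; rewrite -rev_cons Er.
case: w w0 Uw Dw Sw => // w1 w _ Uw Dw Sw.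
have PF : perm_eq ((v :: r) ++ w1 :: w) ((w1 :: w) ++ flatten ps).
  by rewrite perm_catC perm_cat2l -Er perm_rev perm_sym.
exists ((v :: r) ++ w1 :: w); split=> //.
- apply/andP; split; last first.
    rewrite (perm_uniq PF) cat_uniq Uw (perm_uniq F1) /= U1 andbT.
    by apply: contra Dw => /hasP[x xf xw]; apply/hasP; exists x.
  have := sorted_rev (u :: p); rewrite Er /= S1 => Pr.
  by rewrite rcons_cat cat_path Pr Lr.
move=> x y; rewrite cedge_cat -Er edge_in_rev Lr E1 /edge_of /= orbF
  pedge_rcons.
by rewrite -!orbA.
Qed.

Lemma edge_bridge (P : pred T) x w y u v : w != [::] -> all (predC P) w ->
  P u -> P v -> edge_in (x :: rcons w y) u v = false.
Proof.
move=> w0 A Pu Pv.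
have F z z' : ~~ P z' -> link z z' u v = false.
  by move=> Pz'; rewrite linkC (link_out z Pz').
case: w w0 A => // z w _ /= /andP[Pz A]; rewrite F //=.
elim: w z Pz A => [|z' w IH] z Pz /=; first by rewrite linkC F.
by move=> /andP[Pz' A]; rewrite F //= IH.
Qed.

End PathSystems.

(** * Cutting a polygon along a vertical line *)

(** Same formula as [adj], on pairs of natural numbers, so that boxes of all sizes share one
    adjacency. *)
Definition gadj (u v : nat * nat) : bool :=
  `|u.1 - v.1|%N + `|u.2 - v.2|%N == 1.

(** The sizes count vertices: the square of side [L] is [box L.+1 L.+1]. *)
Definition box m n (u : nat * nat) := (u.1 < m) && (u.2 < n).

(* The empty list is allowed: it stands for the empty side of a cut. *)
Definition polygon m n c :=
  [&& ucycleb gadj c, all (box m n) c & (c == [::]) || (2 < size c)].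

Lemma gadjE u v : gadj u v =
  (u.1 == v.1) && ((u.2 == v.2.+1) || (v.2 == u.2.+1)) ||
  (u.2 == v.2) && ((u.1 == v.1.+1) || (v.1 == u.1.+1)).
Proof. by rewrite /gadj; lia. Qed.

Lemma gadj_sym : symmetric gadj.
Proof. by move=> u v; rewrite /gadj distnC [X in _ + X]distnC. Qed.

Definition vline (x y k : nat) : seq (nat * nat) :=
  [seq (x, j) | j <- iota y k].
Definition hline (y x k : nat) : seq (nat * nat) :=
  [seq (j, y) | j <- iota x k].

Lemma mem_vline x y k u : (u \in vline x y k) = (u.1 == x) && (y <= u.2 < y +
  k).
Proof.
apply/mapP/idP => [[j]|]; first by rewrite mem_iota => jk ->; rewrite eqxx.
by case: u => u1 u2 /= /andP[/eqP-> H]; exists u2; rewrite ?mem_iota.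
Qed.

Lemma mem_hline y x k u : (u \in hline y x k) = (u.2 == y) && (x <= u.1 < x +
  k).
Proof.
apply/mapP/idP => [[j]|]; first by rewrite mem_iota => jk ->; rewrite eqxx.
by case: u => u1 u2 /= /andP[/eqP-> H]; exists u1; rewrite ?mem_iota.
Qed.

Lemma vline_uniq x y k : uniq (vline x y k).
Proof. by rewrite map_inj_uniq ?iota_uniq // => ? ? []. Qed.

Lemma hline_uniq y x k : uniq (hline y x k).
Proof. by rewrite map_inj_uniq ?iota_uniq // => ? ? []. Qed.

Lemma last_vline x y k : last (x, y) (vline x y.+1 k) = (x, y + k).
Proof. by elim: k y => [|k IH] y /=; rewrite ?addn0 // IH addSnnS. Qed.

Lemma last_hline y x k : last (x, y) (hline y x.+1 k) = (x + k, y).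
Proof. by elim: k x => [|k IH] x /=; rewrite ?addn0 // IH addSnnS. Qed.

Lemma path_vline x y k : path gadj (x, y) (vline x y.+1 k).
Proof. by elim: k y => //= k IH y; rewrite IH gadjE /= !eqxx orbT. Qed.

Lemma path_hline y x k : path gadj (x, y) (hline y x.+1 k).
Proof. by elim: k x => //= k IH x; rewrite IH gadjE /= !eqxx !orbT. Qed.

(* [s] and [t] are the open ends.  The occupied vertices of column [a.+1] lie
   below [t] and differ from [s], those of column [a.+2] lie below [s]. *)
Lemma close_columns a n (ps : seq (seq (nat * nat))) (s t : nat) (ys : seq
  nat) : path_system gadj ps ->
  perm_eq (ends ps) [seq (a, y) | y <- [:: s, t & ys]] ->
  path ltn s (t :: ys) -> all (gtn n) [:: s, t & ys] ->
  (forall u : nat * nat, u \in flatten ps -> [/\ u.1 <= a.+2, u.2 < n,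
      u.1 = a.+1 -> u.2 < t /\ u.2 <> s & u.1 = a.+2 -> u.2 < s]) ->
  exists c, polygon a.+3 n c /\
    forall u v : nat * nat, u.1 <= a -> v.1 <= a ->
      cedge c u v = edge_of ps u v.
Proof.
have [k] := ubnP (size ys); elim: k ps s t ys => // k IH ps s t ys.
rewrite ltnS => szk Sp Np st sn inb.
have /and3P[lt_st lt_tn _] : [&& s < t, t < n & true] by move: st sn => /=; lia.
(* The link between [s] and [t] through the second extra column; it meets the first extra column
   only at heights [s] and [t]. *)
pose wN := (a.+1, s) :: vline a.+2 s (t - s).+1 ++ [:: (a.+1, t)].
have tE : s + (t - s) = t by lia.
have mem_wN (u : nat * nat) : u \in wN -> u.1 = a.+1 /\ (u.2 = s \/ u.2 = t) \/
   u.1 = a.+2 /\ s <= u.2 <= t.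
  rewrite inE mem_cat mem_vline inE; case: u => x y; rewrite !xpair_eqE /=. lia.
have bN : bridge gadj ps (a, s) (a, t) wN.
  apply/and4P; split=> //.
  - rewrite /wN /= rcons_cat cat_path path_vline last_vline /= !gadjE /=; lia.
  - rewrite /wN [uniq _]/= cat_uniq vline_uniq /= !inE !mem_cat !mem_vline !inE.
    rewrite !xpair_eqE /=; lia.
  by apply/hasPn => u /mem_wN uw; apply/negP => /inb[]; lia.
have ring_out w : (forall u : nat * nat, u \in w -> a < u.1) ->
  all (predC (fun z : nat * nat => z.1 <= a)) w.
  by move=> H; apply/allP => u /H /=; lia.
have outN : all (predC (fun z : nat * nat => z.1 <= a)) wN.
  by apply: ring_out => u /mem_wN; lia.
(* If [s] and [t] are the only ends, the link closes the polygon. Three ends are impossible, since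
   the number of ends is even. *)
case: ys szk Np st sn => [|y1 [|y2 ys]] szk Np st sn.
- have [c [Uc Pc Ec]] := close_ends gadj_sym Sp Np bN.
  exists c; split.
    apply/and3P; split=> //.
      rewrite (perm_all _ Pc) all_cat; apply/andP; split; apply/allP => u.
        by move=> /mem_wN; rewrite /box; lia.
      by move/inb=> []; rewrite /box; lia.
    by rewrite (perm_size Pc) /wN size_cat /= size_cat /= addn1 !addSn orbT.
  move=> u v ua va; rewrite Ec.
  by rewrite (@edge_bridge _ (fun z => z.1 <= a)) ?orbF.
- by have := size_ends Sp; rewrite (perm_size Np) /=; lia.
have ends_in y : y \in [:: s, t, y1, y2 & ys] -> (a, y) \in ends ps.
  by move=> yin; rewrite (perm_mem Np) map_f.
have Ust : uniq [:: (a, t); (a, s); (a, y1)].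
  by move: st; rewrite /= !inE !xpair_eqE; lia.
have sub3 : {subset [:: (a, t); (a, s); (a, y1)] <= ends ps}.
  by move=> u; rewrite !inE => /or3P[]/eqP->; apply: ends_in;
    rewrite !inE eqxx ?orbT.
(* Common end of both cases: the induction hypothesis applies to the linked system, which has two
   ends fewer. If [s'] differs from [s], it exceeds [t], hence avoids the heights already occupied
   in the first extra column. *)
have step (s' t' : nat) ps' (w : seq (nat * nat)) (u v : nat * nat) : u.1 <= a
  -> v.1 <= a ->
    path_system gadj ps' -> 
    perm_eq (flatten ps') (w ++ flatten ps) ->
    perm_eq (ends ps') [seq (a, y) | y <- [:: s', t' & ys]] ->
    (forall x y, edge_of ps' x y = edge_of ps x y || edge_in (u :: rcons w v)
      x y) ->
    bridge gadj ps u v w -> all (predC (fun z : nat * nat => z.1 <= a)) w ->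
    path ltn s' (t' :: ys) -> all (gtn n) [:: s', t' & ys] -> s <= s' ->
      t <= t' -> 
    (s' = s \/ t < s') ->
    (forall u : nat * nat, u \in w -> [/\ u.1 <= a.+2, u.2 < n,
      u.1 = a.+1 -> u.2 < t' /\ u.2 <> s' & u.1 = a.+2 -> u.2 < s']) ->
  exists c, polygon a.+3 n c /\
    forall u v : nat * nat, u.1 <= a -> v.1 <= a ->
      cedge c u v = edge_of ps u v.
  move=> ua va Sp' Fp' Np' Ep' bw ow st' sn' ss' tt' sts winb.
  have [||c [Pc Ec]] := IH ps' s' t' ys _ Sp' Np' st' sn'.
  - exact: ltnW szk.
  - move=> z; rewrite (perm_mem Fp') mem_cat => /orP[/winb//|/inb[z1 z2 z3 z4]].
    by split=> //; clear - ss' tt' sts z3 z4; lia.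
  exists c; split=> // x y xa ya; rewrite Ec // Ep' //.
  rewrite (@edge_bridge _ (fun z => z.1 <= a)) ?orbF //.
  by case/and4P: bw.
have NpE u v (l : seq nat) ps' : perm_eq (ends ps) [:: (a, u), (a, v) & ends
  ps'] ->
    perm_eq [:: s, t, y1, y2 & ys] [:: u, v & l] ->
    perm_eq (ends ps') [seq (a, y) | y <- l].
  move=> N /(perm_map (pair a)) N'.
  rewrite -(perm_cons (a, v)) -(perm_cons (a, u)) -(permPl N).
  by rewrite (permPl Np).
(* Either [t] can be linked to [s], which leaves [y1] and [y2] as the lowest ends, or it can be
   linked to [y1], which leaves [s] and [y2]. *)
case: (joinable_or gadj_sym Sp Ust sub3) => J.
  have wN_rev : bridge gadj ps (a, t) (a, s) (rev wN).
    exact (bridge_rev gadj_sym bN).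
  have [ps' [Sp' Fp' Np' Ep']] := J _ wN_rev.
  apply: (step y1 y2 ps' (rev wN) (a, t) (a, s)) => //.
  - by apply: NpE Np' _; apply/permPl/(perm_catCA [:: s] [:: t]).
  - by rewrite all_rev.
  - by move: st; clear; rewrite /=; lia.
  - by move: sn; clear; rewrite /=; lia.
  - by move: st; clear; rewrite /=; lia.
  - by move: st; clear; rewrite /=; lia.
  - by move: st; clear; rewrite /=; lia.
  - move=> u; rewrite mem_rev => /mem_wN; move: st sn; clear;
      rewrite /= => ? ? ?.
    by split; lia.
pose wM := vline a.+1 t (y1 - t).+1.
have bM : bridge gadj ps (a, t) (a, y1) wM.
  have y1E : t + (y1 - t) = y1 by move: st; clear; rewrite /=; lia.
  apply/and4P; split=> //.
  - rewrite /wM /= rcons_path path_vline last_vline /= y1E !gadjE /=; clear;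
      lia.
  - exact: vline_uniq.
  apply/hasPn => u; rewrite mem_vline => /andP[/eqP u1 uw].
  by apply/negP => /inb[_ _ /(_ u1) [H _] _]; move: uw; rewrite leqNgt H.
have [ps' [Sp' Fp' Np' Ep']] := J _ bM.
apply: (step s y2 ps' wM (a, t) (a, y1)) => //.
- by apply: NpE Np' _; apply/permPl/(perm_catCA [:: s] [:: t; y1]).
- by apply: ring_out => u; rewrite mem_vline => /andP[/eqP-> _]; apply: ltnSn.
- by move: st; clear; rewrite /=; lia.
- by move: sn; clear; rewrite /=; lia.
- by move: st; clear; rewrite /=; lia.
- by left.
- move=> u; rewrite mem_vline; move: st sn; clear; rewrite /= => ? ? ?.
  by split; lia.
Qed.

Lemma cedge_adj c (u v : nat * nat) : cycle gadj c -> cedge c u v -> gadj u v.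
Proof. by move=> Cc /(cedge_rel Cc); rewrite [gadj v u]gadj_sym orbb. Qed.

Lemma pedge_map (T T' : eqType) (f : T -> T') (D : pred T) x p u v :
  {in D &, injective f} -> all D (x :: p) -> D u -> D v ->
  pedge (f x) (map f p) (f u) (f v) = pedge x p u v.
Proof.
move=> fI + Du Dv; elim: p x => //= y p IH x /and3P[Dx Dy Dp].
by rewrite IH ?Dy // /link !(inj_in_eq fI).
Qed.

Lemma cedge_map (T T' : eqType) (f : T -> T') (D : pred T) c u v :
  {in D &, injective f} -> all D c -> D u -> D v ->
  cedge (map f c) (f u) (f v) = cedge c u v.
Proof.
case: c => //= x p fI /andP[Dx Dp] Du Dv.
by rewrite -map_rcons (pedge_map fI) //= Dx all_rcons Dx.
Qed.

Lemma polygon_map (f : nat * nat -> nat * nat) m n m' n' c :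
  {in box m n &, injective f} ->
  {in box m n, forall u, box m' n' (f u)} ->
  {in box m n &, forall u v, gadj u v -> gadj (f u) (f v)} ->
  polygon m n c -> polygon m' n' (map f c).
Proof.
move=> fI fb fa /and3P[/andP[Cc Uc] Bc sc]; apply/and3P; split.
- apply/andP; split.
    rewrite cycle_map; apply: (sub_in_cycle _ Bc Cc).
    by move=> u v ub vb /=; apply: fa.
  by rewrite map_inj_in_uniq // => u v uc vc; apply: fI; apply: (allP Bc).
- by rewrite all_map; apply/allP => u /(allP Bc); apply: fb.
by move: sc; rewrite size_map -!size_eq0 size_map.
Qed.

(** A polygon that leaves the columns up to [a] is traversed from a vertex outside them. The pieces
    inside have their ends in column [a], next to the cut, and are closed up within two more
    columns. *)
Lemma cut_half a m n c : polygon m n c ->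
  exists c', polygon a.+3 n c' /\
    forall u v : nat * nat, u.1 <= a -> v.1 <= a -> cedge c u v = cedge c' u v.
Proof.
move=> Pc; pose P := fun z : nat * nat => z.1 <= a.
have /and3P[/andP[Cc Uc] Bc sc] := Pc.
case: (boolP (all P c)) => [Ac|/allPn[x xc Px]].
  exists c; split=> //; apply/and3P; split=> //; first by apply/andP.
  apply/allP => u uc; have := allP Bc u uc; have := allP Ac u uc.
  by rewrite /P /box => ? /andP[_ ->]; rewrite andbT; lia.
have [k s Es] := rot_to xc.
have Cs : cycle gadj (x :: s) by rewrite -Es rot_cycle.
have goodP y z : P y -> ~~ P z -> gadj y z -> (fun y : nat * nat => y.1 == a) y.
  by rewrite /P gadjE; clear; lia.
have Lx : ~~ P (last x (rcons s x)) by rewrite last_rcons.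
have Us : uniq (seq.filter P (rcons s x)).
  rewrite filter_rcons (negPf Px) filter_uniq //.
  by move: Uc; rewrite -(rot_uniq k) Es => /andP[].
have [ps [Sps Fps Gps Eps]] := cut_path_system gadj_sym goodP Cs Px Lx Us.
have sub (z : nat * nat) : z \in flatten ps -> z.1 <= a /\ z.2 < n.
  move=> /Fps; rewrite mem_filter mem_rcons -Es mem_rot => /andP[Pz zc].
  by split=> //; have /andP[] := allP Bc z zc.
have cE u v : P u -> P v -> cedge c u v = edge_of ps u v.
  by move=> Pu Pv; rewrite -(cedge_rot k) Es -Eps.
pose ys : seq nat := sort leq (map snd (ends ps)).
have endsE : ends ps = [seq (a, y) | y <- map snd (ends ps)].
  rewrite -map_comp -[LHS]map_id; apply/eq_in_map => z /(allP Gps) /eqP za.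
  by case: z za => z1 z2 /= ->.
have Nys : perm_eq (ends ps) [seq (a, y) | y <- ys].
  by rewrite {1}endsE perm_map // perm_sym perm_sort.
(* The ends are distinct and all lie in column [a], so their heights are distinct. *)
have Uys : sorted ltn ys.
  rewrite ltn_sorted_uniq_leq sort_sorted ?andbT; last exact: leq_total.
  rewrite sort_uniq; have := uniq_ends Sps; rewrite {1}endsE.
  exact: map_uniq.
have nys : all (gtn n) ys.
  apply/allP => y; rewrite mem_sort => /mapP[z /ends_sub/sub[_ zn] ->].
  exact: zn.
(* Without ends there is no path, so no edge on this side, and the empty list has the required
   trace. *)
case: ys Nys Uys nys => [|s0 [|t ys]] Nys Uys nys.
- have Z : ps = [::].
    by have := size_ends Sps; rewrite (perm_size Nys) /=; case: (ps).
  by exists [::]; split=> // u v ua va; rewrite cE // Z.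
- by have := size_ends Sps; rewrite (perm_size Nys); case: (size ps).
have [|c' [Pc' Ec']] := close_columns Sps Nys Uys nys.
  move=> u /sub[ua un]; split=> //.
  - exact: leq_trans ua (leq_trans (leqnSn _) (leqnSn _)).
  - by move=> E; rewrite E ltnn in ua.
  - by move=> E; move: ua; rewrite E ltnNge leqnSn.
by exists c'; split=> // u v ua va; rewrite cE // Ec'.
Qed.

(** * Counting polygons *)

(** An injection given by a relation: the images come from existence statements, and one image is
    picked for each element. *)
Lemma leq_card_rel (S T : finType) (A : {set S}) (B : {set T}) (R : S -> T ->
  Prop) :
  (forall x, x \in A -> exists2 y, y \in B & R x y) ->
  (forall x x' y, x \in A -> x' \in A -> R x y -> R x' y -> x = x') ->
  #|A| <= #|B|.
Proof.
move=> ex inj.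
pose f x := [pick y in B | `[< R x y >]].
have fP x : x \in A -> exists y, [/\ f x = Some y, y \in B & R x y].
  move=> xA; rewrite /f; case: pickP => [y /andP[yB /asboolP Rxy]|no].
    by exists y.
  by have [y yB Rxy] := ex x xA; have := no y; rewrite yB (asboolT Rxy).
have fI : {in A &, injective f}.
  move=> x x' xA x'A; have [y [-> _ Rxy]] := fP x xA.
  by have [y' [-> _ Rxy']] := fP x' x'A => -[E]; apply: inj Rxy _; rewrite // E.
have SI : injective (@Some T) by move=> ? ? [].
rewrite -(card_in_imset fI) -(card_imset (mem B) SI).
apply/subset_leq_card/subsetP => z /imsetP[x /fP[y [-> yB _]] ->].
exact: imset_f.
Qed.

Definition coord m n (u : 'I_m * 'I_n) : nat * nat := (val u.1, val u.2).

(** Each edge is recorded in both orders, so all traversals of a polygon have the same code. *)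
Definition code m n (c : seq (nat * nat)) : {set ('I_m * 'I_n) * ('I_m *
  'I_n)} :=
  [set e | cedge c (coord e.1) (coord e.2)].

(** The code of the empty list is included, besides those of the genuine polygons. *)
Definition polys m n : {set {set ('I_m * 'I_n) * ('I_m * 'I_n)}} :=
  [set E | `[< exists2 c, polygon m n c & E = code m n c >]].

Lemma polysP m n E :
  reflect (exists2 c, polygon m n c & E = code m n c) (E \in polys m n).
Proof. by rewrite inE; apply: asboolP. Qed.

Lemma coord_box m n (u : 'I_m * 'I_n) : box m n (coord u).
Proof. by rewrite /box !ltn_ord. Qed.

Lemma boxP m n u : reflect (exists u' : 'I_m * 'I_n, u = coord u') (box m n u).
Proof.
apply: (iffP andP) => [[um un]|[u' ->]]; last by rewrite !ltn_ord.
by exists (Ordinal um, Ordinal un); case: u um un.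
Qed.

Lemma coord_inj m n : injective (@coord m n).
Proof. by move=> [x y] [x' y'] [/val_inj-> /val_inj->]. Qed.

Lemma codeP m n c c' : code m n c = code m n c' <->
  {in box m n &, cedge c =2 cedge c'}.
Proof.
split=> [H u v /boxP[u' ->] /boxP[v' ->]|H].
  by move/setP/(_ (u', v')): H; rewrite !inE.
by apply/setP => -[u v]; rewrite !inE H // [_ \in _]coord_box.
Qed.

Lemma card_polys_map (f : nat * nat -> nat * nat) m n m' n' :
  {in box m n &, injective f} ->
  {in box m n, forall u, box m' n' (f u)} ->
  {in box m n &, forall u v, gadj u v -> gadj (f u) (f v)} ->
  #|polys m n| <= #|polys m' n'|.
Proof.
move=> fI fb fa.
apply: (leq_card_rel (R := fun E E' =>
  exists c, [/\ polygon m n c, E = code m n c &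
  E' = code m' n' (map f c)])) => [E /polysP[c Pc ->]|].
  exists (code m' n' (map f c)); last by exists c.
  by apply/polysP; exists (map f c) => //; apply: polygon_map Pc.
move=> E E' F _ _ [c [Pc -> ->]] [c' [Pc' -> /codeP H]].
apply/codeP => u v ub vb.
have /and3P[_ Bc _] := Pc; have /and3P[_ Bc' _] := Pc'.
by rewrite -(cedge_map fI Bc) // -(cedge_map fI Bc') // H //; apply: fb.
Qed.

Lemma card_polysC m n : #|polys m n| <= #|polys n m|.
Proof.
apply: (card_polys_map (f := fun u => (u.2, u.1))).
- by move=> [x y] [x' y'] _ _ [-> ->].
- by move=> u; rewrite /box /in_mem /= andbC.
by move=> u v _ _; rewrite !gadjE /= orbC.
Qed.

(** A polygon is determined by the rows in which it crosses the cut and by the two polygons that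
    close up its halves. *)
Lemma card_polys_cut a b n :
  #|polys (a.+1 + b.+1) n| <= 2 ^ n * (#|polys a.+3 n| * #|polys b.+3 n|).
Proof.
set m := a.+1 + b.+1.
(* The left-right reflection of the box; it carries the last [b.+1] columns to the first ones, so
   [cut_half] serves for both sides. *)
pose r (u : nat * nat) := (a + b.+1 - u.1, u.2).
pose R E (y : {set 'I_n} * ({set ('I_a.+3 * 'I_n) * ('I_a.+3 * 'I_n)} *
                            {set ('I_b.+3 * 'I_n) * ('I_b.+3 * 'I_n)})) :=
  exists c c1 c2, [/\ polygon m n c /\ E = code m n c,
    y = ([set i : 'I_n | cedge c (a, val i) (a.+1, val i)],
         (code a.+3 n c1, code b.+3 n c2)),
    (forall u v : nat * nat, u.1 <= a -> v.1 <= a ->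
      cedge c u v = cedge c1 u v) &
    {in box m n &, forall u v : nat * nat, a < u.1 -> a < v.1 ->
      cedge c u v = cedge c2 (r u) (r v)}].
have -> : 2 ^ n * (#|polys a.+3 n| * #|polys b.+3 n|) =
   #|setX [set: {set 'I_n}] (setX (polys a.+3 n) (polys b.+3 n))|.
  by rewrite !cardsX -powersetT card_powerset cardsT card_ord.
have rI : {in box m n &, injective r}.
  move=> [x y] [x' y']; rewrite /box /in_mem /= =>
    /andP[xm _] /andP[x'm _] [E ->].
  by congr pair; move: xm x'm E; rewrite /m; clear; lia.
have rb : {in box m n, forall u, box m n (r u)}.
  by move=> [x y]; rewrite /box /in_mem /= => /andP[xm ->]; rewrite andbT /m;
    clear; lia.
have ra : {in box m n &, forall u v, gadj u v -> gadj (r u) (r v)}.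
  move=> [x y] [x' y']; rewrite /box /in_mem /= => /andP[xm _] /andP[x'm _].
  by rewrite !gadjE /=; move: xm x'm; rewrite /m; clear; lia.
apply: (leq_card_rel (R := R)) => [E /polysP[c Pc ->]|].
  have [c1 [P1 E1]] := cut_half a Pc.
  have [c2 [P2 E2]] := cut_half b (polygon_map rI rb ra Pc).
  exists ([set i : 'I_n | cedge c (a, val i) (a.+1, val i)],
         (code a.+3 n c1, code b.+3 n c2)).
    rewrite !in_setX /= in_setT /=; apply/andP.
    by split; apply/polysP; [exists c1|exists c2].
  exists c, c1, c2; split=> // u v ub vb ua va.
  have /and3P[_ Bc _] := Pc.
  rewrite -(cedge_map rI Bc) // E2 // /r /=.
    by move: ua; clear; lia.
  by move: va; clear; lia.
move=> E E' y _ _ [c [c1 [c2 [[Pc ->] ->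
  cl cr]]]] [c' [c1' [c2' [[Pc' ->] Ey cl' cr']]]].
case: Ey => /setP Ex /codeP H1 /codeP H2.
apply/codeP.
(* An edge across the cut is horizontal, joining [(a, i)] to [(a.+1, i)], so its row identifies
   it. *)
have mixed c0 c0' : polygon m n c0 -> 
    (forall i : 'I_n, cedge c0 (a, val i) (a.+1, val i) ->
      cedge c0' (a, val i) (a.+1, val i)) ->
    {in box m n &, forall u v : nat * nat, u.1 <= a < v.1 -> cedge c0 u v ->
      cedge c0' u v}.
  move=> /and3P[/andP[Cc _] _ _] H [x y0] [x' y'] /andP[_ /= yn] _ /= xa uv.
  have := cedge_adj Cc uv; rewrite gadjE /= => adjuv.
  have [Ex0 [Ex' Ey]] : x = a /\ x' = a.+1 /\ y' = y0 by move: xa adjuv;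
    clear; lia.
  by move: uv; rewrite Ex0 Ex' Ey => /(H (Ordinal yn)).
have mixE : {in box m n &, forall u v : nat * nat, u.1 <= a < v.1 ->
  cedge c u v = cedge c' u v}.
  move=> u v ub vb ua; apply/idP/idP.
    by apply: (mixed c c' Pc) => // i; have := Ex i; rewrite !inE => ->.
  by apply: (mixed c' c Pc') => // i; have := Ex i; rewrite !inE => ->.
move=> u v ub vb; case: (leqP u.1 a) => ua; case: (leqP v.1 a) => va.
- rewrite cl // cl' // H1 //; rewrite /box /in_mem /=.
    by have /andP[_ ->] := ub; rewrite andbT; move: ua; clear; lia.
  by have /andP[_ ->] := vb; rewrite andbT; move: va; clear; lia.
- by rewrite mixE // ua.
- by rewrite cedge_sym [RHS]cedge_sym mixE // va.
rewrite cr // cr' // H2 //; rewrite /box /in_mem /=.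
  by have /andP[_ ->] := ub; rewrite andbT; move: ua; clear; lia.
by have /andP[_ ->] := vb; rewrite andbT; move: va; clear; lia.
Qed.

(** * Counting self-avoiding walks *)

Local Notation route m n := (#|{: 'I_m * 'I_n}|.-bseq ('I_m * 'I_n)).

Definition saw m n (u v : nat * nat) p :=
  [&& path gadj u p, uniq (u :: p), all (box m n) (u :: p) & last u p == v].

Definition saws m n : {set route m n} :=
  [set p : route m n |
    saw m n (0, 0) (m.-1, n.-1) (map (@coord m n) p)].

Lemma saw_map (f : nat * nat -> nat * nat) m n m' n' u v p :
  {in box m n &, injective f} ->
  {in box m n, forall u, box m' n' (f u)} ->
  {in box m n &, forall u v, gadj u v -> gadj (f u) (f v)} ->
  saw m n u v p -> saw m' n' (f u) (f v) (map f p).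
Proof.
move=> fI fb fa /and4P[Pp Up Bp /eqP Lp]; apply/and4P; split.
- rewrite path_map; apply: (sub_in_path _ Bp Pp).
  by move=> x y xb yb /=; apply: fa.
- by rewrite -map_cons map_inj_in_uniq // => x y /(allP Bp) xb /(allP Bp);
    apply: fI.
- by rewrite -map_cons all_map; apply/allP => x /(allP Bp); apply: fb.
by rewrite last_map Lp.
Qed.

Lemma saw_cat m n u v u' v' p p' : saw m n u v p -> saw m n u' v' p' ->
  gadj v u' -> ~~ has (mem (u :: p)) (u' :: p') -> saw m n u v' (p ++ u' :: p').
Proof.
move=> /and4P[Pp Up Bp /eqP Lp] /and4P[Pp' Up' Bp' /eqP Lp'] vu D.
apply/and4P; split.
- by rewrite cat_path Pp Lp /= vu.
- by rewrite -cat_cons cat_uniq Up Up' D.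
- by rewrite -cat_cons all_cat Bp.
by rewrite last_cat /= Lp'.
Qed.

Lemma seq_coord m n w : all (box m n) w ->
  exists q : seq ('I_m * 'I_n), map (@coord m n) q = w.
Proof.
elim: w => [|u w IH] /=; first by exists [::].
by case/andP=> /boxP[u' ->] /IH[q <-]; exists (u' :: q).
Qed.

Lemma saws_lift m n p : saw m n (0, 0) (m.-1, n.-1) p ->
  exists2 q, q \in saws m n & map (@coord m n) q = p.
Proof.
move=> Sp; have /and4P[_ /andP[_ Up] /andP[_ Bp] _] := Sp.
have [q Eq] := seq_coord Bp.
have Uq : uniq q by apply: (@map_uniq _ _ (@coord m n)); rewrite Eq.
have sq : size q <= #|{: 'I_m * 'I_n}|.
  by rewrite -(card_uniqP Uq) max_card.
by exists (Bseq sq); rewrite // inE /= Eq.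
Qed.

Lemma coord_bseq_inj m n :
  injective (fun q : route m n => map (@coord m n) q).
Proof. by move=> q q' /(inj_map (@coord_inj m n)) /val_inj. Qed.

Lemma card_sawsC m n : #|saws m n| <= #|saws n m|.
Proof.
pose t (u : nat * nat) := (u.2, u.1).
apply: (leq_card_rel (R := fun (p : route m n) (q : route n m) =>
  map (@coord n m) q = map t (map (@coord m n) p))).
  move=> p; rewrite inE => Sp.
  have [|q qs Eq] := @saws_lift n m (map t (map (@coord m n) p)).
    apply: (@saw_map t m n n m (0, 0) (m.-1, n.-1)) Sp.
    - by move=> [x y] [x' y'] _ _ [-> ->].
    - by move=> u; rewrite /box /in_mem /= andbC.
    by move=> u v _ _; rewrite !gadjE /= orbC.
  by exists q.
move=> p p' q _ _ -> /inj_map H; apply/coord_bseq_inj/H.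
by move=> [x y] [x' y'] [-> ->].
Qed.

(** The second block starts at the first entry that fails [P]. *)
Lemma cat_split (T : eqType) (P : pred T) s1 s1' y y' s2 s2' :
  s1 ++ y :: s2 = s1' ++ y' :: s2' -> all P s1 -> all P s1' -> ~~ P y ->
    ~~ P y' ->
  s1 = s1' /\ y :: s2 = y' :: s2'.
Proof.
elim: s1 s1' => [|x s1 IH] [|x' s1'] //=.
- by move=> [-> _] _ /andP[->].
- by move=> [-> _] /andP[->].
move=> [-> E] /andP[_ A] /andP[_ A'] Py Py'.
by have [-> ->] := IH s1' E A A' Py Py'.
Qed.

(** Three walks are placed side by side, the middle one turned upside down, so that each ends next
    to where the following one starts. An odd number of copies ends at the opposite corner. *)
Lemma card_saws_triple m n : 0 < m -> 0 < n ->
  #|saws m n| ^ 3 <= #|saws (3 * m) n|.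
Proof.
move=> m0 n0.
pose f2 (u : nat * nat) := (m + u.1, n.-1 - u.2).
pose f3 (u : nat * nat) := (2 * m + u.1, u.2).
pose cc (p : route m n) := map (@coord m n) p.
pose R (p : route m n * (route m n * route m n)) (q : route (3 * m) n) :=
  map (@coord (3 * m) n) q = cc p.1 ++ map f2 ((0, 0) :: cc p.2.1) ++
    map f3 ((0, 0) :: cc p.2.2).
have -> : #|saws m n| ^ 3 = #|setX (saws m n) (setX (saws m n) (saws m n))|.
  by rewrite !cardsX !expnS expn0 muln1.
have f1b : {in box m n, forall u, box (3 * m) n u}.
  by move=> [x y]; rewrite /box /in_mem /= => /andP[]; clear; lia.
have f2b : {in box m n, forall u, box (3 * m) n (f2 u)}.
  by move=> [x y]; rewrite /box /in_mem /= => /andP[]; clear; lia.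
have f3b : {in box m n, forall u, box (3 * m) n (f3 u)}.
  by move=> [x y]; rewrite /box /in_mem /= => /andP[]; clear; lia.
have f2I : {in box m n &, injective f2}.
  move=> [x y] [x' y']; rewrite /box /in_mem /= =>
    /andP[_ yn] /andP[_ y'n] [E E'].
  by congr pair; move: yn y'n E E'; clear; lia.
have f3I : {in box m n &, injective f3}.
  move=> [x y] [x' y']; rewrite /box /in_mem /= => _ _ [E ->].
  by congr pair; move: E; clear; lia.
have f2a : {in box m n &, forall u v, gadj u v -> gadj (f2 u) (f2 v)}.
  move=> [x y] [x' y']; rewrite /box /in_mem /= => /andP[_ yn] /andP[_ y'n].
  by rewrite !gadjE /=; move: yn y'n; clear; lia.
have f3a : {in box m n &, forall u v, gadj u v -> gadj (f3 u) (f3 v)}.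
  by move=> [x y] [x' y'] _ _; rewrite !gadjE /=; clear; lia.
apply: (leq_card_rel (R := R)) => [[p1 [p2 p3]]|].
  rewrite !in_setX !inE /= => /and3P[S1 S2 S3].
  have T1 : saw (3 * m) n (0, 0) (m.-1, n.-1) (map id (cc p1)).
    by apply: (@saw_map id m n) S1.
  have T2 := saw_map f2I f2b f2a S2.
  have T3 := saw_map f3I f3b f3a S3.
  have in1 u : u \in (0, 0) :: cc p1 -> u.1 < m.
    by have /and4P[_ _ B _] := S1; move/(allP B)/andP=> [].
  have in2 u : u \in map f2 ((0, 0) :: cc p2) -> m <= u.1 < 2 * m.
    have /and4P[_ _ B _] := S2; case/mapP=> v /(allP B) /andP[vm _] -> /=.
    by move: vm; clear; lia.
  have in3 u : u \in map f3 ((0, 0) :: cc p3) -> 2 * m <= u.1.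
    by case/mapP=> v _ -> /=; clear; lia.
  have T23 : saw (3 * m) n (f2 (0, 0)) (f3 (m.-1, n.-1))
      (map f2 (cc p2) ++ map f3 ((0, 0) :: cc p3)).
    apply: saw_cat T2 T3 _ _.
      by rewrite gadjE /=; move: m0 n0; clear; lia.
    by apply/hasPn => u /in3 H; apply/negP => /in2; move: H; clear; lia.
  have T : saw (3 * m) n (0, 0) ((3 * m).-1, n.-1)
      (cc p1 ++ map f2 ((0, 0) :: cc p2) ++ map f3 ((0, 0) :: cc p3)).
    rewrite map_id in T1.
    have -> : ((3 * m).-1, n.-1) = f3 (m.-1, n.-1).
      by congr pair => /=; move: m0; clear; lia.
    apply: saw_cat T1 T23 _ _.
      by rewrite gadjE /=; move: m0 n0; clear; lia.
    rewrite -cat_cons; apply/hasPn => u; rewrite mem_cat => H.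
    apply/negP => /in1; move: m0; case/orP: H => [/in2|/in3]; clear; lia.
  by have [q qs Eq] := saws_lift T; exists q.
move=> [p1 [p2 p3]] [p1' [p2' p3']] q; rewrite !in_setX !inE /=.
move=> /and3P[S1 S2 S3] /and3P[S1' S2' S3']; rewrite /R /= => -> E.
have A1 p : saw m n (0, 0) (m.-1, n.-1) (cc p) -> all (fun z => z.1 < m) (cc p).
  by case/and4P=> _ _ /andP[_ B] _; apply: sub_all B => z /andP[].
have A2 p : saw m n (0, 0) (m.-1, n.-1) (cc p) ->
    all (fun z => z.1 < 2 * m) (map f2 ((0, 0) :: cc p)).
  case/and4P=> _ _ B _; rewrite all_map; apply: sub_all B => z /andP[] /=.
  by clear; lia.
(* The abscissae lie below [m] in the first block, and below [2 * m] in the second but not in the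
   third, so the three walks can be read off. *)
have [] := cat_split E (A1 _ S1) (A1 _ S1');
  rewrite /= ?addn0 ?ltnn // => E1 E2.
have E3 : map f2 ((0, 0) :: cc p2) ++ f3 (0, 0) :: map f3 (cc p3) =
    map f2 ((0, 0) :: cc p2') ++ f3 (0, 0) :: map f3 (cc p3') by [].
have nf3 : ~~ ((f3 (0, 0)).1 < 2 * m) by rewrite /= addn0 ltnn.
have [[H2] [H3]] := cat_split E3 (A2 _ S2) (A2 _ S2') nf3 nf3.
have inb p : saw m n (0, 0) (m.-1, n.-1) (cc p) -> all (box m n) (cc p).
  by case/and4P=> _ _ /andP[_ B] _.
congr (_, (_, _)); apply: coord_bseq_inj => //.
  by apply: (inj_in_map f2I) H2; apply: inb.
by apply: (inj_in_map f3I) H3; apply: inb.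
Qed.

Lemma card_saws_pow3 m n j : 0 < m -> 0 < n ->
  #|saws m n| ^ (3 ^ j) <= #|saws (3 ^ j * m) n|.
Proof.
move=> m0 n0; elim: j => [|j IH]; first by rewrite expn0 expn1 mul1n.
have mj0 : 0 < 3 ^ j * m by rewrite muln_gt0 expn_gt0.
have -> : 3 ^ j.+1 * m = 3 * (3 ^ j * m) by rewrite expnS mulnA.
rewrite expnSr expnM; apply: leq_trans (card_saws_triple mj0 n0).
by rewrite leq_exp2r.
Qed.

(** Tripling is iterated in one direction, then in the other after a transposition. *)
Lemma card_saws_square n j : 0 < n ->
  #|saws n n| ^ (9 ^ j) <= #|saws (3 ^ j * n) (3 ^ j * n)|.
Proof.
move=> n0; have -> : 9 ^ j = 3 ^ j * 3 ^ j by rewrite -expnMn.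
have jn0 : 0 < 3 ^ j * n by rewrite muln_gt0 expn_gt0.
rewrite expnM; apply: leq_trans (card_saws_pow3 _ n0 jn0).
rewrite leq_exp2r ?expn_gt0 //; apply: leq_trans (card_saws_pow3 _ n0 n0) _.
exact: card_sawsC.
Qed.

(** * Opening a polygon into a crossing walk *)

Lemma highest (c : seq (nat * nat)) : c != [::] ->
  exists2 z, z \in c & all (fun u : nat * nat => u.2 <= z.2) c.
Proof.
elim: c => // u [|v c] IH _; first by exists u; rewrite ?mem_head //= leqnn.
have [z zc zmax] := IH isT; have [uz|zu] := leqP u.2 z.2.
  by exists z; [rewrite inE zc orbT | rewrite [all _ _]/= uz].
exists u; rewrite ?mem_head //; apply/andP; split=> //.
by apply: sub_all zmax => w /leq_trans; apply; apply: ltnW.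
Qed.

(** The walk is reversed if needed, so that it runs from the right end of the removed edge to its
    left end. *)
Lemma open_edge m n y (f : rel (nat * nat)) (a b : nat * nat) l :
  saw m n a b l -> all (fun z : nat * nat => z.2 <= y) (a :: l) ->
  gadj a b -> a.2 = y -> b.2 = y ->
  (forall u v, f u v = edge_in (a :: l) u v || link b a u v) ->
  exists x p, [/\ saw m n (x.+1, y) (x, y) p,
    all (fun z : nat * nat => z.2 <= y) ((x.+1, y) :: p) &
    forall u v, f u v = edge_in ((x.+1, y) :: p) u v || link (x, y) (x.+1, y)
      u v].
Proof.
move=> S A ab ay bY fE; have : a.1 = b.1.+1 \/ b.1 = a.1.+1.
  by move: ab; rewrite gadjE ay bY; clear; lia.
case=> E.
  have Ea : a = (b.1.+1, y) by rewrite -E -ay; case: (a).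
  have Eb : b = (b.1, y) by rewrite -bY; case: (b).
  by exists b.1, l; rewrite -Ea -Eb.
have Eb : b = (a.1.+1, y) by rewrite -E -bY; case: (b).
have Ea : a = (a.1, y) by rewrite -ay; case: (a).
have /and4P[Pl Ul Bl /eqP Ll] := S.
have Er : rev (a :: l) = b :: behead (rev (a :: l)).
  by move: Ll; case: (lastP l) => [|l' z] <-;
    rewrite // -rcons_cons rev_rcons last_rcons.
exists a.1, (behead (rev (a :: l))); rewrite -Eb -Ea -Er; split.
- apply/and4P; split; last 1 first.
  + by rewrite -(last_cons b) -Er rev_cons last_rcons.
  + by have := sorted_rev gadj_sym (a :: l); rewrite Er /= Pl.
  + by rewrite -Er rev_uniq.
  by rewrite -Er all_rev.
- by rewrite all_rev.
by move=> u v; rewrite fE edge_in_rev linkC.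
Qed.

(* The neighbours of a highest vertex of a polygon cannot both lie below it. *)
Lemma open_top m n c : polygon m n c -> c != [::] ->
  exists x y p, [/\ saw m n (x.+1, y) (x, y) p,
    all (fun z : nat * nat => z.2 <= y) ((x.+1, y) :: p) &
    forall u v, cedge c u v =
      edge_in ((x.+1, y) :: p) u v || link (x, y) (x.+1, y) u v].
Proof.
move=> /and3P[/andP[Cc Uc] Bc /orP[/eqP->//|sc]] c0.
have [z zc zmax] := highest c0.
have [k s Es] := rot_to zc.
have Cs : cycle gadj (z :: s) by rewrite -Es rot_cycle.
have Us : uniq (z :: s) by rewrite -Es rot_uniq.
have Bs : all (box m n) (z :: s) by rewrite -Es (eq_all_r (mem_rot k c)).
have Ms : all (fun u : nat * nat =>
  u.2 <= z.2) (z :: s) by rewrite -Es (eq_all_r (mem_rot k c)).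
have cE u v : cedge c u v = cedge (z :: s) u v by rewrite -Es cedge_rot.
have {Es sc} ss : 1 < size s by move: sc; rewrite -(size_rot k) Es.
case: s ss Cs Us Bs Ms cE => // u [//|u' s'] _;
  set s := u' :: s' => Cs Us Bs Ms cE.
have /= := Cs; rewrite rcons_path => /and4P[zu uu' Ps wz].
have uw : u != last u s.
  by have /and3P[_ us _] := Us; apply: contraNneq us => ->;
    apply: (mem_last u' s').
have uz : u.2 <= z.2 by have /and3P[_ -> _] := Ms.
have wz2 : (last u s).2 <= z.2.
  by apply: (allP Ms); rewrite inE mem_last orbT.
(* If both neighbours were strictly lower than [d], both would be the vertex just below it. *)
have side (a b d : nat * nat) : a != b -> gadj d a -> gadj b d ->
    a.2 <= d.2 -> b.2 <= d.2 -> a.2 = d.2 \/ b.2 = d.2.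
  case: a b d => [a1 a2] [b1 b2] [d1 d2]; rewrite xpair_eqE !gadjE /=; clear;
    lia.
have := side _ _ _ uw zu wz uz wz2.
case=> E.
  have S : saw m n u z (rcons s z).
    apply/and4P; split; rewrite ?last_rcons //.
    - by rewrite /= rcons_path uu' Ps.
    - by rewrite -rcons_cons -rot1_cons rot_uniq.
    by rewrite -rcons_cons -rot1_cons (eq_all_r (mem_rot 1 _)).
  have M : all (fun w : nat * nat => w.2 <= z.2) (u :: rcons s z).
    by rewrite -rcons_cons -rot1_cons (eq_all_r (mem_rot 1 _)).
  have [||x [p H]] := @open_edge m n z.2 (cedge c) u z (rcons s z) S M _ E
    erefl.
  - by rewrite gadj_sym.
  - by move=> v w; rewrite cE orbC.
  by exists x, z.2, p.
have S : saw m n z (last u s) (u :: s).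
  apply/and4P; split=> //=.
  by rewrite zu uu'.
have [||x [p H]] := @open_edge m n z.2 (cedge c) z (last u s) (u :: s) S Ms _
  erefl E.
- by rewrite gadj_sym.
- by move=> v w; rewrite cE /= pedge_rcons -!orbA.
by exists x, z.2, p.
Qed.

(** The start lies just above the segment, so the statement covers an empty segment too. *)
Lemma path_vline_rev x y k : path gadj (x, y + k) (rev (vline x y k)).
Proof.
elim: k y => // k IH y; rewrite rev_cons rcons_path -/(vline x y.+1 k).
rewrite addnS -addSn IH /=.
by case: k {IH} => [|k] /=; rewrite ?rev_cons ?last_rcons gadjE /=; clear; lia.
Qed.

Lemma last_vline_rev x y k : last (x, y + k) (rev (vline x y k)) = (x, y).
Proof. by case: k => [|k]; rewrite ?addn0 // rev_cons last_rcons. Qed.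

Lemma path_hline_rev x y k : path gadj (x + k, y) (rev (hline y x k)).
Proof.
elim: k x => // k IH x; rewrite rev_cons rcons_path -/(hline y x.+1 k).
rewrite addnS -addSn IH /=.
by case: k {IH} => [|k] /=; rewrite ?rev_cons ?last_rcons gadjE /=; clear; lia.
Qed.

Lemma last_hline_rev x y k : last (x + k, y) (rev (hline y x k)) = (x, y).
Proof. by case: k => [|k]; rewrite ?addn0 // rev_cons last_rcons. Qed.

Lemma edge_in_catl (T : eqType) (P : pred T) s1 s2 u v :
  all (predC P) s1 -> P u -> P v -> edge_in (s1 ++ s2) u v = edge_in s2 u v.
Proof.
move=> + Pu Pv; elim: s1 => //= x s1 IH /andP[Px A]; rewrite -IH //.
by case: (s1 ++ s2) => //= y s; rewrite (link_out y Px).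
Qed.

Lemma edge_in_catr (T : eqType) (P : pred T) s1 s2 u v :
  all (predC P) s2 -> P u -> P v -> edge_in (s1 ++ s2) u v = edge_in s1 u v.
Proof.
move=> A Pu Pv; rewrite -edge_in_rev rev_cat (@edge_in_catl _ P) ?edge_in_rev
  //.
by rewrite all_rev.
Qed.

Lemma uniq_cat (s1 s2 : seq (nat * nat)) : uniq s1 -> uniq s2 ->
  (forall u : nat * nat, u \in s1 -> u \notin s2) -> uniq (s1 ++ s2).
Proof.
move=> U1 U2 D; rewrite cat_uniq U1 U2 andbT.
by apply/hasPn => u; apply: contraL => /D.
Qed.

(** One leg comes from [(0, S)] along the new row [S] and down column [x]; the other climbs column
    [x.+1], follows row [S] and descends the new column [S]. In the old box both stay strictly above
    height [y], hence above the walk. *)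
Lemma extend_legs S x y p : saw S S (x.+1, y) (x, y) p ->
  all (fun z : nat * nat => z.2 <= y) ((x.+1, y) :: p) ->
  exists q, saw S.+1 S.+1 (0, S) (S, 0) q /\
    {in box S S &, forall u v : nat * nat, u.2 <= y -> v.2 <= y ->
      edge_in ((0, S) :: q) u v = edge_in ((x.+1, y) :: p) u v}.
Proof.
move=> /and4P[Pp Up Bp /eqP Lp] Mp.
set P0 := (x.+1, y) :: p in Up Bp Mp *.
have P0b (u : nat * nat) : u \in P0 -> [/\ u.1 < S, u.2 < S & u.2 <= y].
  by move=> uP; have /andP[-> ->] := allP Bp u uP; rewrite (allP Mp u uP).
have [xS yS _] := P0b _ (mem_head _ _); rewrite /= in xS yS.
pose A := hline S 1 x ++ rev (vline x y.+1 (S - y.+1)).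
pose B := vline x.+1 y.+1 (S - y) ++ hline S x.+2 (S - x.+1) ++ rev (vline S 0
  S).
have Ab (u : nat * nat) : u \in (0, S) :: A ->
  u.2 = S /\ u.1 <= x \/ u.1 = x /\ y < u.2 < S.
  rewrite inE mem_cat mem_rev mem_hline mem_vline; case: u => u1 u2.
  by rewrite xpair_eqE /=; move: xS yS; clear; lia.
have Bb (u : nat * nat) : u \in B ->
  [\/ u.1 = x.+1 /\ y < u.2 <= S, u.2 = S /\ x.+1 < u.1 <= S |
    u.1 = S /\ u.2 < S].
  rewrite !mem_cat mem_rev mem_hline !mem_vline; case: u => u1 u2 /=.
  move=> /or3P[] /andP[/eqP-> H]; [apply: Or31|apply: Or32|apply: Or33].
  - by split=> //; move: H yS; clear; lia.
  - by split=> //; move: H xS; clear; lia.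
  by split=> //; move: H; clear; lia.
have [PA LA] : path gadj (0, S) A /\ last (0, S) A = (x, y.+1).
  have LH : last (0, S) (hline S 1 x) = (x, S) by rewrite (last_hline S 0).
  have SE : (x, S) = (x, y.+1 + (S - y.+1)) by congr pair; move: yS; clear; lia.
  by rewrite cat_path last_cat (path_hline S 0) LH SE path_vline_rev
    last_vline_rev.
have [PB LB] : path gadj (x.+1, y) B /\ last (x.+1, y) B = (S, 0).
  have LV : last (x.+1, y) (vline x.+1 y.+1 (S - y)) = (x.+1, S).
    by rewrite last_vline subnKC // ltnW.
  have LH : last (x.+1, S) (hline S x.+2 (S - x.+1)) = (S, S).
    by rewrite last_hline subnKC // ltnW.
  have SE : (S, S) = (S, 0 + S) by [].
  rewrite !cat_path !last_cat path_vline LV path_hline LH SE.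
  by rewrite path_vline_rev last_vline_rev.
have [PP LP] : sorted gadj (rev P0) /\ last (x, y) (rev P0) = (x.+1, y).
  by rewrite (sorted_rev gadj_sym) rev_cons last_rcons.
have [r Er] : exists r, rev P0 = (x, y) :: r.
  rewrite /P0; case: (lastP p) Lp => [|p' z] <-; first by exists [::].
  by rewrite last_rcons -rcons_cons rev_rcons; eexists.
exists (A ++ rev P0 ++ B); split.
  apply/and4P; split.
  - rewrite cat_path PA LA Er /= cat_path; move: PP LP; rewrite Er /= => -> ->.
    by rewrite PB gadjE /=; clear; lia.
  - rewrite -cat_cons; apply: uniq_cat.
    + rewrite -cat_cons; apply: uniq_cat.
      * rewrite cons_uniq hline_uniq andbT mem_hline /=; clear; lia.
      * by rewrite rev_uniq vline_uniq.
      move=> u; rewrite inE mem_rev mem_hline mem_vline; case: u => u1 u2.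
      by rewrite xpair_eqE /=; clear; lia.
    + apply: uniq_cat; first by rewrite rev_uniq.
      * apply: uniq_cat; first exact: vline_uniq.
          apply: uniq_cat; rewrite ?hline_uniq ?rev_uniq ?vline_uniq //.
          by move=> u; rewrite mem_rev mem_hline mem_vline; clear; lia.
        move=> u; rewrite mem_cat mem_rev mem_hline !mem_vline.
        by move: xS; clear; lia.
      move=> u; rewrite mem_rev => /P0b[H1 H2 H3]; apply/negP => /Bb[];
        move: H1 H2 H3; clear; lia.
    move=> u /Ab H; rewrite mem_cat mem_rev negb_or; apply/andP; split.
      by apply/negP => /P0b[]; move: H; clear; lia.
    by apply/negP => /Bb[]; move: H xS; clear; lia.
  - rewrite -cat_cons all_cat [X in _ && X]all_cat all_rev; apply/and3P; split.
    + by apply/allP => u /Ab; rewrite /box; move: xS; clear; lia.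
    + by apply/allP => u /P0b[]; rewrite /box; clear; lia.
    by apply/allP => u /Bb[]; rewrite /box; move: xS; clear; lia.
  by rewrite last_cat LA last_cat Er; move: LP; rewrite Er /= => ->; rewrite LB.
(* The bound on the abscissa removes column [S], the only place where a leg goes down to height [y]
   or below. *)
move=> u v ub vb uy vy; pose Q (z : nat * nat) := (z.2 <= y) && (z.1 < S).
have [Qu Qv] : Q u /\ Q v.
  by rewrite /Q uy vy; have /andP[-> _] := ub; have /andP[-> _] := vb.
rewrite -cat_cons (@edge_in_catl _ Q) // ?(@edge_in_catr _ Q) ?edge_in_rev //.
  by apply/allP => z /Bb[]; rewrite /Q /=; move: yS; clear; lia.
by apply/allP => z /Ab; rewrite /Q /=; move: yS; clear; lia.
Qed.

(** A nonempty polygon is recovered from the left end of the opened edge and from the crossing walk;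
    the summand 1 counts the empty one. *)
Lemma card_polys_open S : #|polys S S| <= 1 + S * S * #|saws S.+1 S.+1|.
Proof.
(* Turning the picture upside down makes the walk go from [(0, 0)] to [(S, S)]. *)
pose fl (u : nat * nat) := (u.1, S - u.2).
have flI : {in box S.+1 S.+1 &, injective fl}.
  move=> [x y] [x' y']; rewrite /box /in_mem /= =>
    /andP[_ yn] /andP[_ y'n] [-> E].
  by congr pair; move: yn y'n E; clear; lia.
have flb : {in box S.+1 S.+1, forall u, box S.+1 S.+1 (fl u)}.
  by move=> [x y]; rewrite /box /in_mem /= => /andP[-> _]; clear; lia.
have fla : {in box S.+1 S.+1 &, forall u v, gadj u v -> gadj (fl u) (fl v)}.
  move=> [x y] [x' y']; rewrite /box /in_mem /= => /andP[_ yn] /andP[_ y'n].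
  by rewrite !gadjE /=; move: yn y'n; clear; lia.
(* Inside the old box, the edges of the polygon are those of the walk at height at most [y], which
   discards the legs, and the opened edge. *)
pose tr (z : ('I_S * 'I_S) * route S.+1 S.+1) (u v : nat * nat) :=
  [&& u.2 <= val z.1.2, v.2 <= val z.1.2 &
      edge_in (map fl ((0, 0) :: map (@coord S.+1 S.+1) z.2)) u v]
  || link (val z.1.1, val z.1.2) ((val z.1.1).+1, val z.1.2) u v.
pose R (E : {set ('I_S * 'I_S) * ('I_S * 'I_S)}) z := exists c,
  E = code S S c /\ {in box S S &, cedge c =2 tr z}.
rewrite (cardsD1 (code S S [::])).
apply: leq_add; first exact: leq_b1.
have -> : S * S * #|saws S.+1 S.+1| = #|setX [set: 'I_S * 'I_S] (saws S.+1
  S.+1)|.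
  rewrite cardsX cardsT; congr (_ * _).
  by rewrite [RHS]card_prod card_ord.
apply: (leq_card_rel (R := R)) => [E|].
  rewrite in_setD1 => /andP[E0 /polysP[c Pc Ec]].
  have c0 : c != [::] by apply: contraNneq E0 => c0; rewrite Ec c0.
  have [x [y [p [Sp Mp cE]]]] := open_top Pc c0.
  have [q [Sq qE]] := extend_legs Sp Mp.
  have Sq' : saw S.+1 S.+1 (0, 0) (S, S) (map fl q).
    have := saw_map flI flb fla Sq.
    by rewrite /fl /= subnn subn0.
  have [q' q's Eq'] := saws_lift Sq'.
  have [xS yS] : x < S /\ y < S.
    have /and4P[_ _ /andP[/andP[xS yS] _] _] := Sp.
    by split=> //; apply: ltnW.
  exists ((Ordinal xS, Ordinal yS), q'); first by rewrite in_setX in_setT.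
  exists c; split=> // u v ub vb.
  rewrite cE -[tr _ _ _]/([&& u.2 <= y, v.2 <= y &
      edge_in (map fl ((0, 0) :: map (@coord S.+1 S.+1) q')) u v]
    || link (x, y) (x.+1, y) u v) Eq'.
  have flq : map fl ((0, 0) :: map fl q) = (0, S) :: q.
    rewrite /= -map_comp {1}/fl /= subn0; congr (_ :: _).
    have /and4P[_ _ /andP[_ Bq] _] := Sq.
    rewrite -[RHS]map_id; apply/eq_in_map => -[z1 z2] /(allP Bq) /andP[_ /=].
    by rewrite /fl /= ltnS => z2S; rewrite subKn.
  rewrite flq; congr (_ || _).
  case: (leqP u.2 y) => uy /=; last first.
    by apply/negP => /(@edge_in_mem _ ((x.+1, y) :: p) u v) /andP[/(allP Mp)];
      rewrite leqNgt uy.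
  case: (leqP v.2 y) => vy /=; last first.
    by apply/negP => /(@edge_in_mem _ ((x.+1, y) :: p) u v) /andP[_ /(allP
      Mp)]; rewrite leqNgt vy.
  by have := qE u v ub vb uy vy; rewrite /= => ->.
move=> E E' z _ _ [c [-> cE]] [c' [-> cE']].
by apply/codeP => u v ub vb; rewrite cE // cE'.
Qed.

(** * From coordinates to the vertices of the square *)

Lemma cedge_next (T : eqType) (c : seq T) u v : uniq c ->
  cedge c u v = (u \in c) && (v == next c u) || (v \in c) && (u == next c v).
Proof.
move=> Uc; apply/idP/idP => [uv|].
  have /andP[-> ->] := cedge_mem uv.
  have := cedge_rel (cycle_next Uc) uv.
  by rewrite /= ![next _ _ == _]eq_sym.
have H w : w \in c -> cedge c w (next c w).
  move=> wc; have [k s Es] := rot_to wc.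
  rewrite -(cedge_rot k) -(next_rot k Uc) Es.
  by case: s {Es} => [|z s] /=; rewrite /link ?eqxx.
by case/orP=> /andP[/H + /eqP->] //; rewrite cedge_sym.
Qed.

Lemma set2_eq (T : finType) (u v a b : T) : ([set u; v] == [set a;
  b]) = link a b u v.
Proof.
apply/eqP/idP => [/setP E|].
  have := E u; have := E v; have := E a; have := E b;
    rewrite !inE !eqxx ?orbT /=.
  rewrite /link ![a == _]eq_sym ![b == _]eq_sym.
  by case: (u == a); case: (u == b); case: (v == a); case: (v == b).
by case/orP=> /andP[/eqP-> /eqP->] //; rewrite finset.setUC.
Qed.

Lemma mem_cycle_edges L (c : seq (vertex L)) u v : uniq c ->
  ([set u; v] \in cycle_edges c) = cedge c u v.
Proof.
move=> Uc; rewrite cedge_next //; apply/imsetP/idP.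
  move=> [w wc /eqP]; rewrite set2_eq /link.
  by case/orP=> /andP[/eqP-> /eqP->]; rewrite wc eqxx ?orbT.
by case/orP=> /andP[H /eqP->]; [exists u|exists v]; rewrite // finset.setUC.
Qed.

Lemma C_saws L : C L = #|saws L.+1 L.+1|.
Proof.
apply: eq_card => p; rewrite !inE /saw.
have E0 : (0, 0) = coord ((ord0, ord0) : 'I_L.+1 * 'I_L.+1) by [].
have EL : (L, L) = coord ((ord_max, ord_max) : 'I_L.+1 * 'I_L.+1) by [].
rewrite /= EL {1 2 3}E0 path_map last_map (inj_eq (@coord_inj _ _)).
rewrite (mem_map (@coord_inj _ _)) (map_inj_uniq (@coord_inj _ _)).
have -> : all (box L.+1 L.+1) (map (@coord L.+1 L.+1) p).
  by rewrite all_map; apply/allP => u _; apply: coord_box.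
by [].
Qed.

(** Members of a polygon are pairs [[set u; v]], so the code determines the edge set. *)
Lemma P2_polys L : P2 L <= #|polys L.+1 L.+1|.
Proof.
pose R (E : {set {set vertex L}}) (F : {set ('I_L.+1 * 'I_L.+1) * ('I_L.+1 *
  'I_L.+1)}) :=
  forall u v : 'I_L.+1 * 'I_L.+1, ([set u; v] \in E) = ((u, v) \in F).
apply: (leq_card_rel (R := R)).
  move=> E; rewrite inE => /andP[/imsetP[c]];
    rewrite inE => /andP[sc /andP[Cc Uc]] -> _.
  exists (code L.+1 L.+1 (map (@coord L.+1 L.+1) c)); last first.
    move=> u v; rewrite mem_cycle_edges // inE /=.
    rewrite (@cedge_map _ _ _ predT) ?all_predT //.
    by move=> ? ? _ _; apply: coord_inj.
  apply/polysP; exists (map (@coord L.+1 L.+1) c) => //.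
  apply/and3P; split; last by rewrite size_map sc orbT.
    apply/andP; split; first by rewrite cycle_map.
    by rewrite map_inj_uniq //; apply: coord_inj.
  by rewrite all_map; apply/allP => u _; apply: coord_box.
have sub E E' F : E \in polygons L -> R E F -> R E' F -> E \subset E'.
  move=> /imsetP[c _ ->] H H'; apply/subsetP => e ein.
  have /imsetP[w wc Ee] := ein.
  by rewrite Ee H' -H -Ee.
move=> E E' F; rewrite !inE => /andP[PE _] /andP[PE' _] H H'.
by apply/eqP; rewrite eqEsubset (sub _ _ F PE) // (sub _ _ F PE').
Qed.

Lemma P4_le_P2 L : P4 L <= P2 L.
Proof.
apply/subset_leq_card/subsetP => E; rewrite !inE => /andP[-> /and4P[-> -> _ _]].
by [].
Qed.

(** * Closing a crossing walk into a polygon *)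

(** The starting vertex lies on the first edge only, which gives the second vertex; then the
    argument repeats from there. *)
Lemma pedge_determined (T : eqType) (x : T) p q : uniq (x :: p) ->
  uniq (x :: q) ->
  pedge x p =2 pedge x q -> p = q.
Proof.
elim: p x q => [|y p IH] x [|y' q] //.
- by move=> _ _ /(_ x y'); rewrite /= /link !eqxx.
- by move=> _ _ /(_ x y); rewrite /= /link !eqxx.
move=> /andP[xp Up] /andP[xq Uq] E.
have Ey : y = y'.
  have := E x y; rewrite /= {1}/link !eqxx /=.
  move/esym/orP=> [/orP[/andP[_ /eqP//]|/andP[/eqP xy' _]]|].
    by rewrite xy' mem_head in xq.
  by move/(@edge_in_mem _ (y' :: q)) => /andP[H]; rewrite H in xq.
rewrite -Ey in xq Uq E *; congr (_ :: _); apply: (IH y) => // u v.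
have := E u v => /=; case: (boolP (link x y u v)) => //= lk _.
have F (r : seq T) : x \notin y :: r -> pedge y r u v = false.
  move=> xr; apply/negP => /(@edge_in_mem _ (y :: r)) /andP[ur vr].
  by case/orP: lk xr => /andP[/eqP H /eqP H']; [rewrite -H ur | rewrite -H' vr].
by rewrite !F.
Qed.

Lemma polygon_lift L c : polygon L.+1 L.+1 c -> 2 < size c ->
  exists E, [/\ E \in polygons L,
    (forall u v, ([set u; v] \in E) = cedge c (coord u) (coord v)) &
    forall u v, cedge c u v -> exists u' v' : vertex L,
      [/\ coord u' = u, coord v' = v, [set u'; v'] \in E & [set u';
        v'] \in edges L]].
Proof.
move=> /and3P[/andP[Cc Uc] Bc _] sc.
have [c' Ec] := seq_coord Bc.
have Uc' : uniq c' by apply: (@map_uniq _ _ (@coord L.+1 L.+1)); rewrite Ec.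
have Cc' : cycle (@adj L) c' by rewrite -Ec cycle_map in Cc.
have zc' : size c' <= #|vertex L| by rewrite -(card_uniqP Uc') max_card.
have sc' : 2 < size c' by rewrite -(size_map (@coord L.+1 L.+1)) Ec.
have cE u v : ([set u; v] \in cycle_edges c') = cedge c (coord u) (coord v).
  rewrite mem_cycle_edges // -Ec (@cedge_map _ _ _ predT) ?all_predT //.
  by move=> ? ? _ _; apply: coord_inj.
exists (cycle_edges c'); split=> //.
  by apply/imsetP; exists (Bseq zc'); rewrite // inE sc' /ucycleb Cc' Uc'.
move=> u v uv; have /andP[uc vc] := cedge_mem uv.
have /boxP[u' Eu] := allP Bc u uc; have /boxP[v' Ev] := allP Bc v vc.
exists u', v'; rewrite cE -Eu -Ev; split=> //.
rewrite inE; apply/existsP; exists u'; apply/existsP; exists v';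
  rewrite eqxx andbT.
by have := cedge_adj Cc uv; rewrite Eu Ev.
Qed.

(** The image of the walk runs from [(1, L.+1)] to [(L.+1, 1)] and is the part of the polygon where
    both coordinates are positive; a walk with known start is determined by its edges. *)
Lemma C_le_P4 L : C L <= P4 L.+1.
Proof.
rewrite C_saws.
pose f (u : nat * nat) := (u.1.+1, (L - u.2).+1).
have fI : {in box L.+1 L.+1 &, injective f}.
  move=> [x y] [x' y']; rewrite /box /in_mem /= =>
    /andP[_ yn] /andP[_ y'n] [-> E].
  by congr pair; move: yn y'n E; clear; lia.
have fb : {in box L.+1 L.+1, forall u, box L.+2 L.+2 (f u)}.
  by move=> [x y]; rewrite /box /in_mem /= => /andP[]; clear; lia.
have fa : {in box L.+1 L.+1 &, forall u v, gadj u v -> gadj (f u) (f v)}.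
  move=> [x y] [x' y']; rewrite /box /in_mem /= => /andP[_ yn] /andP[_ y'n].
  by rewrite !gadjE /=; move: yn y'n; clear; lia.
pose w (p : route L.+1 L.+1) := (0, 0) :: map (@coord L.+1 L.+1) p.
pose R (p : route L.+1 L.+1) (E : {set {set vertex L.+1}}) :=
  forall u v : vertex L.+1, 0 < u.1 -> 0 < u.2 -> 0 < v.1 -> 0 < v.2 ->
    ([set u; v] \in E) = edge_in (map f (w p)) (coord u) (coord v).
apply: (leq_card_rel (R := R)) => [p|].
  rewrite inE => Sp.
  have /and4P[Pf Uf Bf /eqP Lf] := saw_map fI fb fa Sp.
  (* The closing path runs from [(L.+1, 0)] along the bottom side to the origin and up the left side
     to [(0, L.+1)]. *)
  pose Z' := rev (hline 0 0 L.+1) ++ vline 0 1 L.+1.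
  pose Z := (L.+1, 0) :: Z'.
  have [PZ LZ] : path gadj (L.+1, 0) Z' /\ last (L.+1, 0) Z' = (0, L.+1).
    rewrite cat_path last_cat -{1 2 3}[L.+1]add0n path_hline_rev last_hline_rev.
    by rewrite (path_vline 0 0) (last_vline 0 0).
  have Zb (u : nat * nat) : u \in Z ->
      [/\ u.1 < L.+2, u.2 < L.+2 & ~~ ((0 < u.1) && (0 < u.2))].
    rewrite inE mem_cat mem_rev mem_hline mem_vline; case: u => u1 u2.
    by rewrite xpair_eqE /= => H; split; move: H; clear; lia.
  have UZ : uniq Z.
    rewrite cons_uniq mem_cat mem_rev mem_hline mem_vline /=; apply/andP; split.
      by clear; lia.
    apply: uniq_cat; rewrite ?rev_uniq ?hline_uniq ?vline_uniq // => u.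
    by rewrite mem_rev mem_hline mem_vline; clear; lia.
  have fpos (u : nat * nat) : u \in map f (w p) -> (0 < u.1) && (0 < u.2).
    by case/mapP=> v _ ->.
  have f0 : f (0, 0) = (1, L.+1) by rewrite /f /= subn0.
  have fL : f (L, L) = (L.+1, 1) by rewrite /f /= subnn.
  have Efw : map f (w p) = f (0, 0) :: map f (map (@coord L.+1 L.+1) p) by [].
  pose c := map f (w p) ++ Z.
  have cE u v : cedge c u v = [|| edge_in (map f (w p)) u v,
      link (L.+1, 1) (L.+1, 0) u v, edge_in Z u v
    | link (0, L.+1) (1, L.+1) u v].
    by rewrite /c Efw cedge_cat LZ Lf f0 fL.
  have sc : 2 < size c.
    by rewrite size_cat /= size_cat size_rev !size_map !size_iota; clear; lia.
  have Pc : polygon L.+2 L.+2 c.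
    apply/and3P; split; last by rewrite sc orbT.
      apply/andP; split.
        rewrite /c Efw /cycle /= rcons_cat cat_path Pf Lf /= rcons_path PZ LZ
          f0 fL.
        by rewrite !gadjE /=; clear; lia.
      apply: uniq_cat => // u /fpos H; apply/negP => /Zb[_ _].
      by rewrite H.
    rewrite all_cat; apply/andP; split; first exact: Bf.
    by apply/allP => u /Zb[H1 H2 _]; apply/andP.
  have [E [PE EE cedgeE]] := polygon_lift Pc sc.
  have side (P : vertex L.+1 -> bool) u v : cedge c u v ->
      (forall u', coord u' = u -> P u') -> (forall v', coord v' = v -> P v') ->
      has_edge_in E [set e in edges L.+1 | [forall v in e, P v]].
    move=> /cedgeE[u' [v' [Eu Ev inE' ined]]] Pu Pv.
    apply/existsP; exists [set u'; v']; rewrite inE' inE ined /=.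
    by apply/forall_inP => z; rewrite !inE => /orP[]/eqP->;
      [apply: Pu|apply: Pv].
  have EZ u v : edge_in Z u v -> cedge c u v by move=> H; rewrite cE H !orbT.
  exists E.
    rewrite inE PE /=; apply/and4P; split.
    - apply: (side (fun z => z.2 == L.+1 :> nat) (0, L.+1) (1, L.+1)).
      + by rewrite cE [link (0, _) _ _ _]/link !eqxx !orbT.
      + by move=> u' [_ ->].
      by move=> u' [_ ->].
    - apply: (side (fun z => z.2 == 0 :> nat) (1, 0) (0, 0)).
      + apply: EZ; rewrite /Z /Z' -cat_cons edge_in_cat.
        have -> : (L.+1, 0) :: rev (hline 0 0 L.+1) = rev (hline 0 0 L.+2).
          by rewrite -[in RHS]addn1 /hline iotaD map_cat rev_cat.
        by rewrite edge_in_rev.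
      + by move=> u' [_ ->].
      by move=> u' [_ ->].
    - apply: (side (fun z => z.1 == 0 :> nat) (0, 0) (0, 1)).
      + apply: EZ; rewrite /Z /Z' -cat_cons edge_in_cat.
        by rewrite (last_hline_rev 0 0 L.+1 : last (L.+1, 0) _ = _) /link
          !eqxx !orbT.
      + by move=> u' [-> _].
      by move=> u' [-> _].
    apply: (side (fun z => z.1 == L.+1 :> nat) (L.+1, 1) (L.+1, 0)).
    + by rewrite cE [link (L.+1, 1) _ _ _]/link !eqxx !orbT.
    + by move=> u' [-> _].
    by move=> u' [-> _].
  move=> u v u1 u2 v1 v2; rewrite EE.
  pose Q (z : nat * nat) := (0 < z.1) && (0 < z.2).
  have [Qu Qv] : Q (coord u) /\ Q (coord v) by split; apply/andP.
  have L1 : link (L.+1, 1) (L.+1, 0) (coord u) (coord v) = false.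
    by rewrite linkC (@link_out _ Q).
  have L2 : link (0, L.+1) (1, L.+1) (coord u) (coord v) = false.
    by rewrite (@link_out _ Q).
  rewrite cE L1 L2.
  have -> : edge_in Z (coord u) (coord v) = false.
    by apply/negP => /edge_in_mem /andP[/Zb[_ _]]; rewrite u1 u2.
  by rewrite !orbF.
move=> p p' E; rewrite !inE => Sp Sp' H H'.
apply: coord_bseq_inj.
have /and4P[_ Up Bp _] := Sp; have /and4P[_ Up' Bp' _] := Sp'.
apply: (pedge_determined Up Up') => x y.
have out (q : route L.+1 L.+1) : all (box L.+1 L.+1) (w q) ->
    ~~ (box L.+1 L.+1 x && box L.+1 L.+1 y) -> edge_in (w q) x y = false.
  move=> Bq nb; apply/negP => /edge_in_mem /andP[xq yq].
  by case/negP: nb; rewrite !(allP Bq).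
case: (boolP (box L.+1 L.+1 x && box L.+1 L.+1 y)) => [/andP[xb yb]|nb];
  last first.
  by rewrite -[LHS]/(edge_in (w p) x y) -[RHS]/(edge_in (w p') x y) !out.
have [/boxP[u Eu] /boxP[v Ev]] : box L.+2 L.+2 (f x) /\ box L.+2 L.+2 (f y).
  by split; apply: fb.
rewrite -(pedge_map fI Bp xb yb) -(pedge_map fI Bp' xb yb) Eu Ev.
have [u1 v1] : (0 < u.1) && (0 < u.2) /\ (0 < v.1) && (0 < v.2).
  by split; [have := Eu|have := Ev]; rewrite /f /coord /= => -[<- <-].
have [/andP[u1a u1b] /andP[v1a v1b]] := (u1, v1).
have := H u v u1a u1b v1a v1b; rewrite H' //; exact: esym.
Qed.

(** * Iterating the cuts *)

(** Each cut takes off [d.+2] columns. With two columns added to each side, the pieces have widths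
    [d.+4] and [d.+4 + k * d], so the width decreases by [d]. *)
Lemma card_polys_iter d k n :
  #|polys (d.+4 + k * d) n| <= 2 ^ (k * n) * #|polys d.+4 n| ^ k.+1.
Proof.
elim: k => [|k IH]; first by rewrite mul0n addn0 expn0 expn1 mul1n.
have -> : d.+4 + k.+1 * d = d.+2 + (d.+1 + k * d).+1 by rewrite mulSn; lia.
apply: leq_trans (card_polys_cut _ _ _) _.
have -> : (d.+1 + k * d).+3 = d.+4 + k * d by lia.
rewrite [_ ^ k.+2]expnS mulSn expnD -!mulnA leq_mul2l expn_eq0 /=.
by rewrite [leqRHS]mulnCA leq_mul2l IH orbT.
Qed.

Lemma card_polys_square d k :
  #|polys (d.+4 + k * d) (d.+4 + k * d)| <=
  (2 ^ (2 * d.+4) * #|polys d.+4 d.+4|) ^ (k.+1 * k.+1).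
Proof.
set q := #|polys d.+4 d.+4|; set N := _ + _.
have H : #|polys d.+4 N| <= 2 ^ (k * d.+4) * q ^ k.+1.
  exact: leq_trans (card_polysC _ _) (card_polys_iter _ _ _).
apply: leq_trans (card_polys_iter _ _ _) _.
apply: (@leq_trans (2 ^ (k * N) * (2 ^ (k * d.+4) * q ^ k.+1) ^ k.+1)).
  by rewrite leq_mul2l leq_exp2r ?H ?orbT.
rewrite (expnMn (2 ^ (k * d.+4))) (expnMn (2 ^ (2 * d.+4))) -!expnM mulnA
  -expnD.
rewrite leq_mul2r leq_exp2l //.
(* Both exponents of 2 are at most [k * k.+1 * d.+4], because [N] is at most [k.+1 * d.+4]. *)
by apply/orP; right; rewrite /N; nia.
Qed.

Lemma C_le_polys L : C L <= #|polys L.+2 L.+2|.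
Proof.
exact: leq_trans (C_le_P4 L) (leq_trans (P4_le_P2 _) (P2_polys _)).
Qed.

Lemma C_growth n j : 0 < n -> C n.-1 ^ (9 ^ j) <= C (3 ^ j * n).-1.
Proof.
move=> n0; rewrite !C_saws !prednK ?muln_gt0 ?expn_gt0 //.
exact: card_saws_square.
Qed.

(** The two ways around a unit square; this makes [ln lam] positive, so that it can be divided
    by. *)
Lemma C1_ge2 : 2 <= C 1.
Proof.
rewrite C_saws.
have [|q1 q1s E1] := @saws_lift 2 2 [:: (1, 0); (1, 1)].
  by [].
have [|q2 q2s E2] := @saws_lift 2 2 [:: (0, 1); (1, 1)].
  by [].
have ne : q1 != q2 by apply/eqP => E; have := E1; rewrite E E2.
have c2 : #|[set q1; q2]| = 2 by rewrite cards2 ne.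
by rewrite -{1}c2; apply/subset_leq_card/subsetP => q;
  rewrite in_set2 => /orP[]/eqP->.
Qed.

End Combinatorics.

(** * Asymptotics *)

Local Open Scope classical_set_scope.
Local Open Scope ring_scope.

Section LnNat.
Variable R : realType.
Local Notation lnn n := (ln (n%:R : R)).

(** The convention [ln 0 = 0] lets this bound and the next ones hold for all natural numbers. *)
Lemma ln_nat_ge0 n : 0 <= lnn n.
Proof. by case: n => [|n]; [rewrite ln0 | rewrite ln_ge0 // ler1n]. Qed.

Lemma ler_ln_nat m n : (m <= n)%N -> lnn m <= lnn n.
Proof.
case: m => [|m] mn; first by rewrite ln0 // ln_nat_ge0.
by rewrite ler_ln ?posrE ?ltr0n ?ler_nat // (leq_trans _ mn).
Qed.

Lemma ln_natX m n : lnn (m ^ n)%N = n%:R * lnn m.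
Proof.
case: m => [|m]; last by rewrite natrX lnXn ?ltr0n // mulr_natl.
case: n => [|n]; first by rewrite expn0 ln1 mul0r.
by rewrite exp0n // ln0 // mulr0.
Qed.

Lemma ln_natM_le m n : lnn (m * n)%N <= lnn m + lnn n.
Proof.
case: m => [|m]; first by rewrite mul0n ln0 // add0r ln_nat_ge0.
case: n => [|n]; first by rewrite muln0 ln0 // addr0 ln_nat_ge0.
by rewrite natrM lnM // posrE ltr0n.
Qed.

(** The number of places where a polygon can be opened is at most [2 ^ (2 * s)], so it only costs a
    term linear in [s]. *)
Lemma ln_open_le s c : lnn (1 + s * s * c)%N <= s%:R * 2 * lnn 2 + lnn c.
Proof.
case: c => [|c].
  rewrite muln0 addn0 ln1 [X in _ + X]ln0 // addr0.
  by apply: mulr_ge0 (ln_nat_ge0 2); rewrite mulr_ge0.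
have ss : (s.+1 * s.+1 <= 2 ^ (s * 2))%N.
  by rewrite expnM -mulnn leq_mul // ltn_expl.
have le : (1 + s * s * c.+1 <= 2 ^ (s * 2) * c.+1)%N.
  by apply: (@leq_trans (s.+1 * s.+1 * c.+1)%N);
    [nia|rewrite leq_mul2r ss orbT].
apply: le_trans (ler_ln_nat le) _; apply: le_trans (ln_natM_le _ _) _.
by rewrite lerD2r ln_natX natrM.
Qed.

(** * Two-sided bounds for the logarithm of [C L] *)

Variables (lam : R).
Hypothesis lamE : lnn (C L) / L%:R ^+ 2 @[L --> \oo] --> ln lam.

(** The limit may be taken along any sequence of sizes tending to infinity. *)
Lemma ln_lam_ge (x : R) (m : nat -> nat) : (forall j, j <= m j)%N ->
  (forall j, (0 < j)%N -> x <= lnn (C (m j)) / (m j)%:R ^+ 2) -> x <= ln lam.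
Proof.
move=> mj H.
have mo : m j @[j --> \oo] --> \oo.
  by apply/cvgnyPge => A; exists A => // j /= Aj; apply: leq_trans Aj (mj j).
have cv := cvg_comp _ _ mo lamE.
rewrite -(cvg_lim (@Rhausdorff R) cv); apply: limr_ge; first by apply/cvg_ex;
  exists (ln lam).
by exists 1%N => // j /= j1; apply: H.
Qed.

Lemma ln_lam_le (x : R) (m : nat -> nat) : (forall j, j <= m j)%N ->
  (forall j, (0 < j)%N -> lnn (C (m j)) / (m j)%:R ^+ 2 <= x) -> ln lam <= x.
Proof.
move=> mj H.
have mo : m j @[j --> \oo] --> \oo.
  by apply/cvgnyPge => A; exists A => // j /= Aj; apply: leq_trans Aj (mj j).
have cv := cvg_comp _ _ mo lamE.
rewrite -(cvg_lim (@Rhausdorff R) cv); apply: limr_le; first by apply/cvg_ex;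
  exists (ln lam).
by exists 1%N => // j /= j1; apply: H.
Qed.

(** By [C_growth], along the sizes [3 ^ j * L.+1 - 1] the normalized logarithm never falls below
    [lnn (C L) / L.+1%:R ^+ 2]. *)
Lemma ln_C_le L : lnn (C L) <= L.+1%:R ^+ 2 * ln lam.
Proof.
have n0 : 0 < L.+1%:R ^+ 2 :> R by rewrite exprn_gt0.
rewrite mulrC -ler_pdivrMr //.
pose m j := (3 ^ j * L.+1).-1%N.
have mge j : (j <= m j)%N.
  have := ltn_expl j (isT : 1 < 3)%N; rewrite /m; nia.
apply: (ln_lam_ge mge) => j j0.
have m0 : (0 < m j)%N := leq_trans j0 (mge j).
have := ler_ln_nat (C_growth j (isT : 0 < L.+1)%N);
  rewrite ln_natX -/(m j) => H.
have mS : (m j)%:R ^+ 2 <= (9 ^ j)%:R * L.+1%:R ^+ 2 :> R.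
  rewrite -natrX -natrX -natrM ler_nat.
  have -> : (9 ^ j = 3 ^ j * 3 ^ j)%N by rewrite -expnMn.
  by rewrite /m; nia.
rewrite ler_pdivrMr // mulrAC ler_pdivlMr ?exprn_gt0 ?ltr0n //.
apply: (@le_trans _ _ (lnn (C L) * ((9 ^ j)%:R * L.+1%:R ^+ 2))).
  by rewrite ler_wpM2l ?ln_nat_ge0.
by rewrite mulrA ler_wpM2r ?(ltW n0) // mulrC.
Qed.

Lemma ln_lam_gt0 : 0 < ln lam.
Proof.
have := le_trans (ler_ln_nat C1_ge2) (ln_C_le 1).
have : 0 < lnn 2 by rewrite ln_gt0 // ltr1n.
by move=> h /(lt_le_trans h); rewrite pmulr_rgt0 // exprn_gt0.
Qed.

Lemma ln_C_ge d : (0 < d)%N ->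
  d%:R ^+ 2 * ln lam <= lnn (C d.+4) + d.+4%:R * 4 * lnn 2.
Proof.
move=> d0.
have d20 : 0 < d%:R ^+ 2 :> R by rewrite exprn_gt0 // ltr0n.
rewrite mulrC -ler_pdivlMr //.
(* A crossing walk of this size closes up in a box of [d.+4 + k * d] columns, the width reached by
   the iterated cuts. *)
pose m k := (d.+2 + k * d)%N.
have mge k : (k <= m k)%N by rewrite /m; nia.
apply: (ln_lam_le mge) => k k0.
set q := #|polys d.+4 d.+4|.
have Hk := leq_trans (C_le_polys (m k)) (card_polys_square d k).
have := ler_ln_nat Hk; rewrite ln_natX -/q => {}Hk.
set B := lnn (2 ^ (2 * d.+4) * q)%N in Hk.
have B0 : 0 <= B := ln_nat_ge0 _.
(* Cutting and opening each contribute [2 * d.+4] times [ln 2]. *)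
have BE : B <= lnn (C d.+4) + d.+4%:R * 4 * lnn 2.
  apply: le_trans (ln_natM_le _ _) _; rewrite ln_natX.
  have := ler_ln_nat (card_polys_open d.+4); rewrite -C_saws -/q => Hq.
  have {Hq} := le_trans Hq (ln_open_le _ _).
  rewrite natrM => Hq.
  apply: le_trans (_ : 2%:R * d.+4%:R * lnn 2 + (d.+4%:R * 2 * lnn 2 + lnn (C
    d.+4)) <= _).
    by rewrite lerD2l.
  by rewrite le_eqVlt; apply/orP; left; apply/eqP; ring.
have m0 : (0 < m k)%N by [].
have kd : (k.+1 * k.+1)%:R * d%:R ^+ 2 <= (m k)%:R ^+ 2 :> R.
  by rewrite -natrX -natrX -natrM ler_nat /m; nia.
apply: (@le_trans _ _ (B / d%:R ^+ 2)); last by rewrite ler_pM2r // invr_gt0.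
rewrite ler_pdivrMr ?exprn_gt0 ?ltr0n // mulrAC ler_pdivlMr //.
apply: le_trans (_ : (k.+1 * k.+1)%:R * B * d%:R ^+ 2 <= _).
  by rewrite ler_wpM2r ?(ltW d20).
by rewrite -mulrA mulrCA ler_wpM2l.
Qed.

(** Any count between [C L.-1] and the number of polygons has the same logarithm up to a linear
    error; this treats [P2] and [P4] together. *)
Lemma eq_pow_C (A : nat -> nat) : (forall L, C L <= A L.+1)%N ->
  (forall L, A L <= #|polys L.+1 L.+1|)%N -> eq_pow_sqr_bigO lam A.
Proof.
move=> CA AP; set l := ln lam.
have l0 : 0 < l := ln_lam_gt0.
(* The coefficient 10 comes from expanding the square of [L - 5] in the lower bound, and 4 is the
   coefficient of [ln 2] there; the upper bound needs less. *)
pose K := (10 * l + 4 * lnn 2) / l.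
exists (fun L => lnn (A L) / l - L%:R ^+ 2), K.
have [N _ HN] : \forall L \near \oo, 0 < lnn (C L) / L%:R ^+ 2.
  exact: cvgr_gt lamE 0 l0.
(* This gives [M = L - 1] at least [N], so that [C M] is positive, and [d = L - 5] positive. *)
exists (N + 6)%N => // L /= NL.
have [M EL] : exists M, L = M.+1 by exists L.-1; lia.
have [d Ed] : exists d, M = d.+4 by exists (M - 4)%N; lia.
have d0 : (0 < d)%N by lia.
have CM : (C M <= A L)%N by rewrite EL.
have CM0 : (0 < C M)%N.
  have := HN M; rewrite lt0n => /(_ _)/=; move=> h; apply/eqP => C0.
  by have := h (ltac:(rewrite /=; lia)); rewrite C0 ln0 // mul0r ltxx.
split.
- exact: leq_trans CM0 CM.
- by rewrite addrC subrK divfK // gt_eqF.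
have rE : lnn (A L) / l - L%:R ^+ 2 = (lnn (A L) - L%:R ^+ 2 * l) / l.
  by rewrite mulrBl mulfK // gt_eqF.
rewrite rE normrM [`|l^-1|]gtr0_norm ?invr_gt0 // /K [X in _ <= X]mulrAC
  ler_pM2r ?invr_gt0 //.
have lo : d%:R ^+ 2 * l - M%:R * 4 * lnn 2 <= lnn (A L).
  rewrite lerBlDr; apply: le_trans (ln_C_ge d0) _.
  by rewrite Ed lerD2r; apply: ler_ln_nat; rewrite -Ed.
have up : lnn (A L) <= L.+1%:R * 2 * lnn 2 + L.+2%:R ^+ 2 * l.
  have := leq_trans (AP L) (card_polys_open _);
    rewrite -C_saws => /ler_ln_nat H.
  apply: le_trans H _; apply: le_trans (ln_open_le _ _) _.
  by rewrite lerD2l ln_C_le.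
have ln20 : 0 <= lnn 2 := ln_nat_ge0 2.
have dE : d%:R = L%:R - 5 :> R by rewrite EL Ed;
  rewrite -addn1 -[d.+4]addn4 !natrD; ring.
have ME : M%:R = L%:R - 1 :> R by rewrite EL -addn1 natrD addrK.
have L6 : 6 <= L%:R :> R by rewrite ler_nat; lia.
move: lo up; rewrite dE ME -[L.+2%:R]natr1 -[L.+1%:R]natr1.
move: (lnn (A L)) (L%:R : R) L6 (lnn 2) ln20 (l) l0 => a x x6 b b0 l' l'0 lo up.
have xl : 0 <= (x - 6) * l' by rewrite mulr_ge0 ?subr_ge0 // ltW.
have xb : 0 <= (x - 6) * b by rewrite mulr_ge0 ?subr_ge0.
rewrite ler_norml; apply/andP; split; lra.
Qed.

End LnNat.

Theorem theorem2 (R : realType) (lam : R) (lam_gt0 : 0 < lam)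
    (lamE : ln ((C L)%:R : R) / L%:R ^+ 2 @[L --> \oo] --> ln lam) :
  eq_pow_sqr_bigO lam P2 /\ eq_pow_sqr_bigO lam P4.
Proof.
split; apply: eq_pow_C lamE _ _ _ => L.
- exact: leq_trans (C_le_P4 L) (P4_le_P2 _).
- exact: P2_polys.
- exact: C_le_P4.
exact: leq_trans (P4_le_P2 L) (P2_polys L).
Qed.
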